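(* Let $0\le s\le m$ and $0\le r\le n$ be integers and let $p$ be $0$ or a prime. If $s\le 3$, or $m-s\le 1$, or $m-s=n-r=2$, then $\mathrm{T}_{m,n}(s,r,p)=\mathrm{T}_{m,n}(s,r,0)$.
   Context: Write $[n]=\{1,\dots,n\}$. For integers $0\le s\le m$, $0\le r\le n$ and $p$ equal to $0$ or a prime, the tensor matroid $\mathrm{T}_{m,n}(s,r,p)$ is the following matroid on $[m]\times[n]$. Let $K$ be a field of characteristic $p$ and let $u_1,\dots,u_m\in K^s$, $v_1,\dots,v_n\in K^r$ be vectors all of whose coordinates (all $ms+nr$ of them together) are algebraically independent over the prime field. A set $E\subseteq[m]\times[n]$ is independent if and only if the vectors $u_i\otimes v_j$, indexed by $(i,j)\in E$, are linearly independent in $K^s\otimes K^r$. This matroid depends only on $m,n,s,r,p$. *)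

(* Defs.v *)
From HB Require Import structures.
From mathcomp Require Export all_boot all_order all_algebra.
From mathcomp.real_closed Require Export mxtens.
From mathcomp.multinomials Require Export mpoly.

Set Implicit Arguments.
Unset Strict Implicit.
Unset Printing Implicit Defensive.

Import GRing.Theory.
Local Open Scope ring_scope.

Definition matroid_axioms (T : finType) (I : {set {set T}}) : bool :=
  [&& set0 \in I,
      [forall A in I, forall B : {set T}, (B \subset A) ==> (B \in I)]
    & [forall A in I, forall B in I,
        (#|A| < #|B|)%N ==> [exists x in B :\: A, x |: A \in I]]].

Record matroid (T : finType) := Matroid {
  indep : {set {set T}};
  indepP : matroid_axioms indep
}.
HB.instance Definition _ (T : finType) := [isSub for @indep T].

Section LinearMatroid.
Variables (K : fieldType) (vT : vectType K) (T : finType) (f : T -> vT).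

(* The vectors form a family indexed by A: a repeated vector makes it
   dependent. *)
Definition linear_indep : {set {set T}} :=
  [set A : {set T} | free [seq f x | x in A]].

Lemma linear_indep_sub (A B : {set T}) :
  A \in linear_indep -> B \subset A -> B \in linear_indep.
Proof.
rewrite !inE => freeA sBA.
suff peB : perm_eq (enum B) (filter (mem B) (enum A)).
  move: freeA; rewrite /image_mem.
  rewrite -(perm_free (perm_map f (permEl (perm_filterC (mem B) (enum A))))).
  by rewrite map_cat (perm_free (perm_map f peB)) => /catl_free.
apply: uniq_perm => [||x].
- exact: enum_uniq.
- exact/filter_uniq/enum_uniq.
- rewrite [in RHS]mem_filter.
  rewrite !mem_enum /=.
  by case xB: (x \in B) => //=; rewrite (subsetP sBA).
Qed.

Lemma linear_indep_axioms : matroid_axioms linear_indep.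
Proof.
apply/and3P; split.
- by rewrite inE /image_mem enum_set0 nil_free.
- apply/forall_inP => A IA; apply/forallP => B; apply/implyP.
  exact: linear_indep_sub.
- apply/forall_inP => A IA; apply/forall_inP => B IB; apply/implyP => ltAB.
  apply: contraLR ltAB => /exists_inPn noaug; rewrite -leqNgt.
  rewrite !inE in IA IB.
  suff sBA : (<<[seq f x | x in B]>> <= <<[seq f x | x in A]>>)%VS.
    have := dimvS sBA.
    by move: IA IB; rewrite /free => /eqP-> /eqP->; rewrite !size_image.
  apply/span_subvP => _ /imageP[x xB ->].
  have [xA | xNA] := boolP (x \in A).
    by apply: memv_span; apply: image_f.
  have := noaug x; rewrite inE xNA xB inE => /(_ isT).
  have pe : perm_eq (enum (x |: A)) (x :: enum A).
    apply: uniq_perm => [||y].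
    - exact: enum_uniq.
    - by rewrite /= mem_enum xNA enum_uniq.
    - by rewrite !(inE, mem_enum).
  rewrite /image_mem (perm_free (perm_map f pe)) /= free_cons.
  by rewrite IA andbT negbK.
Qed.

Definition linear_matroid : matroid T := Matroid linear_indep_axioms.

End LinearMatroid.

Definition has_char (K : fieldType) (p : nat) : Prop :=
  if p == 0%N then [pchar K] =i pred0 else p \in [pchar K].

Definition in_prime_field (K : fieldType) (x : K) : Prop :=
  exists a b : int, x = a%:~R / b%:~R.

Definition alg_indep (K : fieldType) (N : nat) (x : 'I_N -> K) : Prop :=
  forall q : {mpoly K[N]},
    (forall a : 'X_{1..N}, in_prime_field q@_a) -> q.@[x] = 0 -> q = 0.

(* Row i of U is u_i and row j of V is v_j, so all m * s + n * r coordinates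
   are listed in a single row. *)
Definition generic_vectors (K : fieldType) (m s n r : nat)
    (U : 'M[K]_(m, s)) (V : 'M[K]_(n, r)) : Prop :=
  alg_indep (fun k => row_mx (mxvec U) (mxvec V) ord0 k).

(* K^s (x) K^r is 'rV[K]_(s * r), with the Kronecker product *t as the tensor
   product of row vectors. *)
Definition tensor_matroid (K : fieldType) (m s n r : nat)
    (U : 'M[K]_(m, s)) (V : 'M[K]_(n, r)) : matroid ('I_m * 'I_n)%type :=
  linear_matroid
    (fun ij : 'I_m * 'I_n => row ij.1 U *t row ij.2 V : 'rV[K]_(s * r)).

(* Main.v *)
From HB Require Import structures.
From mathcomp Require Import perm zify ring.
Require Import Defs.

(** A nonzero value of an integral polynomial in the coordinates at one
    configuration forces a nonzero value at every generic configuration over a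
    field in which no further integers vanish.  So bases in characteristic p are
    bases in characteristic 0, and for the converse it suffices to find, for each
    basis E in characteristic 0, one configuration in characteristic p at which
    the tensors u_i (x) v_j, (i, j) in E, are independent.

    If m - s <= 1, being a basis says that the annihilators W_i of
    {v_j : (i, j) in E} are independent subspaces.  In a basis adapted to the
    W_i the matrix V acquires zeros, and nonzero terms in the Leibniz expansions
    of its minors show that a generic matrix over K with the same zero pattern
    has the same property.

    If s <= 3, normalise r rows of V to the identity.  A vector v_j that is used
    at most once is a combination of basis vectors, and one of its summands must
    keep the family independent, so v_j may be replaced by a basis vector; this
    settles the case where few columns of E have two or more elements.
    Otherwise s = 3 and, dually, each coordinate of V may be concentrated in a
    single row; what remains is independence of families of at most three lines
    spanned by points u_i of the plane, which is a combinatorial condition.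

    If m - s = n - r = 2, the complement of E is independent in the matroid of
    the forms dlog(r_i c_j (x_i - x_j)), for distinct points x.  Such a system is
    specialised by merging the points one at a time: as a function of the
    position of the merged cluster, a suitable minor has degree too small to
    vanish at all of the remaining points.  Once all points are merged one is
    left with the incidence matrix of a bipartite graph, whose independence does
    not depend on the field, and the specialisations can then be undone over K. *)

Set Implicit Arguments.
Unset Strict Implicit.
Unset Printing Implicit Defensive.
Import GRing.Theory.
Local Open Scope ring_scope.

(** * Independent and spanning sets of tensors *)

Lemma free_imageP (K : fieldType) (vT : vectType K) (T : finType)
    (f : T -> vT) (A : {set T}) :
  free [seq f x | x in A] <->
  (forall c : T -> K, \sum_(x in A) c x *: f x = 0 ->
     forall x, x \in A -> c x = 0).
Proof.
have sz : size (image f A) = size (enum A) by rewrite size_map.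
split=> [freeA c c0 x xA | indA].
  have /freeP fr : free (in_tuple [seq f x | x in A]) by [].
  pose k (i : 'I_(size (image f A))) : K := c (nth x (enum A) i).
  have k0 : \sum_i k i *: [seq f x | x in A]`_i = 0.
    rewrite -[RHS]c0; transitivity (\sum_(y <- enum A) c y *: f y); last first.
      by rewrite big_enum.
    rewrite [RHS](big_nth x) -sz big_mkord.
    apply: eq_bigr => i _; rewrite /k; congr (_ *: _).
    by rewrite /image_mem (nth_map x) // -sz.
  have xi : (index x (enum A) < size (image f A))%N.
    by rewrite sz index_mem mem_enum.
  have := fr k k0 (Ordinal xi).
  by rewrite /k /= nth_index // mem_enum.
suff : free (in_tuple [seq f x | x in A]) by [].
apply/freeP => k k0 i.
have x0 : T.
  case: (enum A) (sz) => [|x s] sz'; last exact: x.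
  by case: i => i; rewrite sz' ltn0.
pose c x := if insub (index x (enum A)) is Some j then k j else 0.
have ci (j : 'I_(size (image f A))) : c (nth x0 (enum A) j) = k j.
  rewrite /c index_uniq ?enum_uniq -?sz //.
  by case: insubP => [j' _ /val_inj->|]; rewrite ?ltn_ord.
rewrite -(ci i); apply: indA; last first.
  by rewrite -mem_enum mem_nth // -sz.
rewrite -[RHS]k0; transitivity (\sum_(y <- enum A) c y *: f y).
  by rewrite big_enum.
rewrite [LHS](big_nth x0) -sz big_mkord.
apply: eq_bigr => j _; rewrite ci; congr (_ *: _).
by rewrite /image_mem (nth_map x0) // -sz.
Qed.

(* X is the matrix of coefficients of a linear relation between the tensors
   indexed by E, and C below a linear form on K^s (x) K^r. *)
Definition indep_at (K : fieldType) m s n r (U : 'M[K]_(m, s))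
    (V : 'M[K]_(n, r)) (E : {set 'I_m * 'I_n}) :=
  forall X : 'M[K]_(m, n), (forall i j, (i, j) \notin E -> X i j = 0) ->
    U^T *m X *m V = 0 -> X = 0.

Definition spans_at (K : fieldType) m s n r (U : 'M[K]_(m, s))
    (V : 'M[K]_(n, r)) (E : {set 'I_m * 'I_n}) :=
  forall C : 'M[K]_(s, r),
    (forall i j, (i, j) \in E -> (U *m C *m V^T) i j = 0) -> C = 0.

Lemma mulmx3E (R : pzRingType) m s r n (U : 'M[R]_(m, s)) (C : 'M[R]_(s, r))
    (W : 'M[R]_(r, n)) i j :
  (U *m C *m W) i j = \sum_a \sum_b U i a * C a b * W b j.
Proof.
rewrite !mxE exchange_big /=; apply: eq_bigr => b _.
by rewrite mxE mulr_suml.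
Qed.

Lemma tens_rowE (R : pzRingType) s r (u : 'rV[R]_s) (v : 'rV[R]_r) i a b :
  (u *t v) i (mxtens_index (a, b)) = u 0 a * v 0 b.
Proof.
rewrite -tensmxE (_ : mxtens_index (0, 0) = i) //.
by apply: val_inj; case: i => -[].
Qed.

Lemma tensor_matroidP (K : fieldType) m s n r (U : 'M[K]_(m, s))
    (V : 'M[K]_(n, r)) (E : {set 'I_m * 'I_n}) :
  E \in indep (tensor_matroid U V) <-> indep_at U V E.
Proof.
have key (c : 'I_m * 'I_n -> K) a b :
    (\sum_(x in E) c x *: (row x.1 U *t row x.2 V : 'rV[K]_(s * r)))
      ord0 (mxtens_index (a, b)) =
    \sum_i \sum_j U i a * (if (i, j) \in E then c (i, j) else 0) * V j b.
  rewrite summxE pair_big /= big_mkcond /=; apply: eq_bigr => -[i j] _ /=.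
  case: ifP => _; last by rewrite mulr0 mul0r.
  by rewrite mxE tens_rowE !mxE mulrA [c _ * _]mulrC.
rewrite inE free_imageP; split=> [indE X XE X0 | indE c c0 [i j] ijE].
  apply/matrixP => i j; rewrite mxE.
  have [ijE|/XE//] := boolP ((i, j) \in E).
  apply: (indE (fun x => X x.1 x.2) _ _ ijE).
  apply/rowP => k; rewrite mxE -[k]mxtens_unindexK.
  case: (mxtens_unindex k) => a b; rewrite key.
  move/matrixP/(_ a b): X0; rewrite mulmx3E mxE => X0; rewrite -[RHS]X0.
  apply: eq_bigr => i' _; apply: eq_bigr => j' _ /=; rewrite mxE.
  by case: ifP => // /negbT/XE ->.
pose X : 'M[K]_(m, n) :=
  \matrix_(i, j) if (i, j) \in E then c (i, j) else 0.
have /matrixP/(_ i j) : X = 0; last by rewrite !mxE ijE.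
apply: indE => [i' j' /negbTE nE|]; first by rewrite mxE nE.
apply/matrixP => a b; rewrite mulmx3E mxE.
move/rowP/(_ (mxtens_index (a, b))): c0; rewrite key mxE => c0.
rewrite -[RHS]c0; apply: eq_bigr => i' _; apply: eq_bigr => j' _ /=.
by rewrite !mxE.
Qed.

Lemma det_mulmxr_inj (K : fieldType) n (A : 'M[K]_n) :
  \det A != 0 <-> (forall v : 'cV_n, A *m v = 0 -> v = 0).
Proof.
split=> [dA v Av|inj].
  have uA : A \in unitmx by rewrite unitmxE unitfE.
  by rewrite -[v]mul1mx -(mulVmx uA) -mulmxA Av mulmx0.
apply/negP; rewrite -det_tr => /det0P[v v0 vA]; case/negP: v0.
by rewrite -[v]trmxK (inj v^T) ?trmx0 // -[A]trmxK -trmx_mul vA trmx0.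
Qed.

Lemma det_mulmxl_inj (K : fieldType) n (A : 'M[K]_n) :
  \det A != 0 <-> (forall v : 'rV_n, v *m A = 0 -> v = 0).
Proof.
rewrite -det_tr det_mulmxr_inj; split=> inj v vA.
  by rewrite -[v]trmxK (inj v^T) ?trmx0 // -trmx_mul vA trmx0.
by rewrite -[v]trmxK (inj v^T) ?trmx0 // -[A]trmxK -trmx_mul vA trmx0.
Qed.

(** Defined over any ring, so that the same matrix can be formed from indeterminates and then
    evaluated in every field. *)
Definition tensor_rows (R : pzRingType) m s n r N (U : 'M[R]_(m, s))
    (V : 'M[R]_(n, r)) (e : 'I_N -> 'I_m * 'I_n) : 'M[R]_(N, s * r) :=
  \matrix_(k, c) (U (e k).1 (mxtens_unindex c).1
                  * V (e k).2 (mxtens_unindex c).2).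

Section Bases.
Variables (K : fieldType) (m s n r : nat).
Variables (U : 'M[K]_(m, s)) (V : 'M[K]_(n, r)).
Variables (N : nat) (e : 'I_N -> 'I_m * 'I_n) (E : {set 'I_m * 'I_n}).
Hypotheses (e_inj : injective e) (defE : E = [set e k | k : 'I_N]).

(** A vector in the right kernel is a linear form on the tensor space vanishing on [E]. The left
    kernel, treated next, consists of the relations among the tensors. *)
Lemma tensor_rows_spans :
  (forall v : 'cV_(s * r), tensor_rows U V e *m v = 0 -> v = 0) <->
  spans_at U V E.
Proof.
have key (C : 'M[K]_(s, r)) k :
    (tensor_rows U V e *m \col_c C (mxtens_unindex c).1 (mxtens_unindex c).2)
      k 0 = (U *m C *m V^T) (e k).1 (e k).2.
  rewrite mulmx3E pair_bigA mxE.
  rewrite (reindex (@mxtens_index s r)); last first.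
    by exists (@mxtens_unindex s r) => ? _; rewrite ?mxtens_indexK ?mxtens_unindexK.
  apply: eq_bigr => -[a b] _; rewrite !mxE !mxtens_indexK.
  by rewrite /= mulrAC.
split=> [inj C CE | spE v v0].
  have /inj/colP C0 : tensor_rows U V e *m
      \col_c C (mxtens_unindex c).1 (mxtens_unindex c).2 = 0.
    apply/colP => k; rewrite key [RHS]mxE; apply: CE.
    by rewrite -surjective_pairing defE imset_f.
  apply/matrixP => a b; have := C0 (mxtens_index (a, b)).
  by rewrite !mxE mxtens_indexK.
pose C : 'M[K]_(s, r) := \matrix_(a, b) v (mxtens_index (a, b)) 0.
have vC : v = \col_c C (mxtens_unindex c).1 (mxtens_unindex c).2.
  apply/colP => c; rewrite !mxE -surjective_pairing mxtens_unindexK.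
  by congr (v _ _); apply: val_inj; rewrite /= [RHS]ord1.
suff C0 : C = 0 by rewrite vC C0; apply/colP => c; rewrite !mxE.
apply: spE => i j; rewrite defE => /imsetP[k _ ek].
by have := key C k; rewrite -vC v0 mxE -ek.
Qed.

Lemma tensor_rows_indep :
  (forall v : 'rV_N, v *m tensor_rows U V e = 0 -> v = 0) <->
  indep_at U V E.
Proof.
have key (X : 'M[K]_(m, n)) a b : (forall i j, (i, j) \notin E -> X i j = 0) ->
    (\row_k X (e k).1 (e k).2 *m tensor_rows U V e) 0 (mxtens_index (a, b))
      = (U^T *m X *m V) a b.
  move=> XE; rewrite mulmx3E pair_big /= mxE.
  rewrite [RHS](bigID [pred x | x \in E]) /= [X in _ + X]big1 ?addr0; last first.
    by case=> i j /XE /= ->; rewrite mulr0 mul0r.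
  rewrite defE big_imset /=; last by move=> ? ? _ _; apply: e_inj.
  apply: eq_bigr => k _; rewrite !mxE mxtens_indexK /=.
  by rewrite mulrA [X _ _ * _]mulrC.
split=> [inj X XE X0 | indE v v0].
  have /inj/rowP XV : \row_k X (e k).1 (e k).2 *m tensor_rows U V e = 0.
    apply/rowP => c; rewrite -[c]mxtens_unindexK.
    by case: (mxtens_unindex c) => a b; rewrite key // X0 !mxE.
  apply/matrixP => i j; rewrite [RHS]mxE.
  have [|/XE//] := boolP ((i, j) \in E); rewrite defE => /imsetP[k _ ek].
  by have := XV k; rewrite !mxE -ek.
pose X : 'M[K]_(m, n) :=
  \matrix_(i, j) if [pick k | e k == (i, j)] is Some k then v 0 k else 0.
have XE i j : (i, j) \notin E -> X i j = 0.
  move=> nE; rewrite mxE; case: pickP => // k /eqP ek.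
  by case/negP: nE; rewrite defE -ek imset_f.
have Xe k : X (e k).1 (e k).2 = v 0 k.
  rewrite mxE -surjective_pairing; case: pickP => [k' /eqP/e_inj-> //|].
  by move/(_ k); rewrite eqxx.
have Xv : \row_k X (e k).1 (e k).2 = v by apply/rowP => k; rewrite mxE Xe.
have X0 : X = 0.
  apply: indE => //; apply/matrixP => a b.
  by rewrite -key // Xv v0 !mxE.
by rewrite -Xv X0; apply/rowP => k; rewrite !mxE.
Qed.

End Bases.

Lemma enum_base (T : finType) (E : {set T}) N : #|E| = N ->
  exists2 e : 'I_N -> T, injective e & E = [set e k | k : 'I_N].
Proof.
move=> <-; exists enum_val; first exact: enum_val_inj.
apply/setP => x; apply/idP/imsetP => [xE|[k _ ->]]; last exact: enum_valP.
by exists (enum_rank_in xE x); rewrite ?enum_rankK_in.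
Qed.

(** With [s * r] elements the matrix of tensors is square, and both properties say that its
    determinant is nonzero. *)
Lemma spans_indep (K : fieldType) m s n r (U : 'M[K]_(m, s))
    (V : 'M[K]_(n, r)) (E : {set 'I_m * 'I_n}) :
  #|E| = (s * r)%N -> spans_at U V E <-> indep_at U V E.
Proof.
move=> /enum_base[e e_inj defE].
rewrite -(tensor_rows_spans _ _ defE) -(tensor_rows_indep _ _ e_inj defE).
by rewrite -det_mulmxr_inj -det_mulmxl_inj.
Qed.

Lemma indep_spans_card (K : fieldType) m s n r (U : 'M[K]_(m, s))
    (V : 'M[K]_(n, r)) (E : {set 'I_m * 'I_n}) :
  indep_at U V E -> spans_at U V E -> #|E| = (s * r)%N.
Proof.
have [e e_inj defE] := enum_base (erefl #|E|).
move=> /(tensor_rows_indep U V e_inj defE) injl.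
move=> /(tensor_rows_spans U V defE) injr.
set T := tensor_rows U V e in injl injr.
have fr : row_free T by apply/inj_row_free/injl.
have fl : row_free T^T.
  apply/inj_row_free => v vT; rewrite -[v]trmxK (injr v^T) ?trmx0 //.
  by rewrite -[T]trmxK -trmx_mul vT trmx0.
by move: fr fl; rewrite /row_free mxrank_tr => /eqP -> /eqP ->.
Qed.

(** A maximal independent [B] containing [A] spans: a form vanishing on [B] but not at [(i, j)]
    would allow [(i, j)] to be added to [B]. *)
Lemma indep_spans_ext (K : fieldType) m s n r (U : 'M[K]_(m, s))
    (V : 'M[K]_(n, r)) (A : {set 'I_m * 'I_n}) :
  spans_at U V setT -> indep_at U V A ->
  exists2 B : {set 'I_m * 'I_n}, A \subset B & indep_at U V B /\ #|B| = (s * r)%N.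
Proof.
move=> spT /tensor_matroidP indA.
pose I := indep (tensor_matroid U V).
have AA : (A \subset A) && (A \in I) by rewrite subxx.
have [B /andP[sAB /tensor_matroidP indB] maxB] :=
  @arg_maxnP _ A (fun B => (A \subset B) && (B \in I)) (fun B => #|B|) AA.
exists B => //; split=> //; apply: (indep_spans_card indB) => C CB.
apply: spT => i j _; have [/CB //|nB] := boolP ((i, j) \in B).
apply/eqP/negPn/negP => Cij.
have : (i, j) |: B \in I.
  apply/tensor_matroidP => X XE X0.
  (* This pairs the relation [X] with the form [C], and [U^T *m X *m V = 0] makes the pairing
     vanish. Since [C] vanishes on [B], only the term at [(i, j)] survives. *)
  have trX : \sum_k \sum_l X k l * (U *m C *m V^T) k l = 0.
    transitivity (\tr (X^T *m (U *m C *m V^T))).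
      rewrite /mxtrace exchange_big; apply: eq_bigr => l _ /=.
      by rewrite [RHS]mxE; apply: eq_bigr => k _; rewrite [X^T l k]mxE.
    rewrite [X^T *m _]mulmxA mxtrace_mulC !mulmxA.
    have -> : V^T *m X^T *m U = (U^T *m X *m V)^T.
      by rewrite !trmx_mul trmxK mulmxA.
    by rewrite X0 trmx0 mul0mx mxtrace0.
  have Xij : X i j = 0.
    apply/eqP; move/eqP: trX; rewrite pair_big /= (bigD1 (i, j)) //=.
    rewrite big1 ?addr0 ?mulf_eq0 ?(negbTE Cij) ?orbF // => -[k l] /= nkl.
    have [/CB->|nkB] := boolP ((k, l) \in B); first by rewrite mulr0.
    by rewrite XE ?mul0r // !inE negb_or nkl.
  apply: indB (X0) => k l nkl; have [[-> ->] //|nkl'] := eqVneq (k, l) (i, j).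
  by rewrite XE // !inE negb_or nkl'.
move=> IB; have := maxB ((i, j) |: B).
rewrite IB (subset_trans sAB) ?subsetUr // cardsU1 nB => /(_ isT).
by rewrite add1n /= ltnn.
Qed.

(** * Genericity and change of characteristic *)

(** Integral polynomials have values in every field, so they can carry a nonvanishing statement from
    one characteristic to another. *)
Definition coord_eval (K : fieldType) m s n r (U : 'M[K]_(m, s))
    (V : 'M[K]_(n, r)) : {mpoly int[m * s + n * r]} -> K :=
  mmap intr (fun k => row_mx (mxvec U) (mxvec V) ord0 k).

HB.instance Definition _ K m s n r U V :=
  GRing.RMorphism.on (@coord_eval K m s n r U V).

Definition varU m s n r : 'M[{mpoly int[m * s + n * r]}]_(m, s) :=
  \matrix_(i, a) 'X_(lshift _ (mxvec_index i a)).

Definition varV m s n r : 'M[{mpoly int[m * s + n * r]}]_(n, r) :=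
  \matrix_(j, b) 'X_(rshift _ (mxvec_index j b)).

Lemma coord_eval_varU (K : fieldType) m s n r (U : 'M[K]_(m, s))
    (V : 'M[K]_(n, r)) : map_mx (coord_eval U V) (varU m s n r) = U.
Proof.
by apply/matrixP => i a; rewrite !mxE /coord_eval mmapX mmap1U row_mxEl mxvecE.
Qed.

Lemma coord_eval_varV (K : fieldType) m s n r (U : 'M[K]_(m, s))
    (V : 'M[K]_(n, r)) : map_mx (coord_eval U V) (varV m s n r) = V.
Proof.
by apply/matrixP => j b; rewrite !mxE /coord_eval mmapX mmap1U row_mxEr mxvecE.
Qed.

(** If [P] vanished at the generic point, its image over [K] would be the zero polynomial. All its
    integer coefficients would then vanish in [K], hence in [L], and [P] would vanish everywhere
    over [L]. *)
Lemma generic_transfer (L K : fieldType) m s n r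
    (U' : 'M[L]_(m, s)) (V' : 'M[L]_(n, r))
    (U : 'M[K]_(m, s)) (V : 'M[K]_(n, r)) P :
  (forall z : int, z%:~R != 0 :> L -> z%:~R != 0 :> K) ->
  generic_vectors U V -> coord_eval U' V' P != 0 -> coord_eval U V P != 0.
Proof.
move=> charLK gUV; apply: contra => /eqP P0; apply/eqP.
have Q0 : map_mpoly (intr : int -> K) P = 0.
  apply: gUV => [a|].
    by exists P@_a, 1; rewrite mcoeff_map_mpoly divr1.
  rewrite -[RHS]P0 /coord_eval /meval.
  (* A common bound on both sizes lets the two evaluations be expanded over the same monomials. *)
  pose k := maxn (msize P) (msize (map_mpoly (intr : int -> K) P)).
  rewrite (mmapE k) ?leq_maxr // (mmapE k) ?leq_maxl //.
  by apply: eq_bigr => a _; rewrite mcoeff_map_mpoly.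
rewrite /coord_eval /mmap big1_seq // => a _.
suff -> : (P@_a)%:~R = 0 :> L by rewrite mul0r.
apply/eqP; have := contraNT (charLK P@_a); rewrite negbK; apply.
by rewrite -mcoeff_map_mpoly Q0 mcoeff0.
Qed.

(** One point where the minor is nonzero suffices, and the matrix whose selected rows form the
    identity is such a point. *)
Lemma generic_det_rowsubU (K : fieldType) m s n r (U : 'M[K]_(m, s))
    (V : 'M[K]_(n, r)) (h : 'I_s -> 'I_m) :
  generic_vectors U V -> injective h -> \det (rowsub h U) != 0.
Proof.
move=> gUV h_inj; pose P := \det (rowsub h (varU m s n r)).
have evP U' V' : coord_eval U' V' P = \det (rowsub h U') :> K.
  by rewrite /P -det_map_mx map_mxsub coord_eval_varU.
rewrite -(evP U V).
apply: (generic_transfer (L := K) (U' := \matrix_(i, a) (i == h a)%:R) (V' := 0) (fun=> id) gUV).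
rewrite evP (_ : rowsub _ _ = 1%:M) ?det1 ?oner_neq0 //.
by apply/matrixP => a b; rewrite !mxE (inj_eq h_inj).
Qed.

Definition mask (R : pzRingType) n r (Z : 'I_n -> 'I_r -> bool)
    (V : 'M[R]_(n, r)) : 'M[R]_(n, r) :=
  \matrix_(j, k) if Z j k then V j k else 0.

Lemma map_mask (R S : pzRingType) (f : {rmorphism R -> S}) n r
    (Z : 'I_n -> 'I_r -> bool) (V : 'M[R]_(n, r)) :
  map_mx f (mask Z V) = mask Z (map_mx f V).
Proof. by apply/matrixP => j k; rewrite !mxE; case: ifP; rewrite ?rmorph0. Qed.

(** The minor is the identity at the 0/1 matrix with ones at the positions [(h a, c a)], and [Z]
    permits these positions. *)
Lemma generic_det_mask (K : fieldType) m s n r (U : 'M[K]_(m, s))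
    (V : 'M[K]_(n, r)) (Z : 'I_n -> 'I_r -> bool) N
    (h : 'I_N -> 'I_n) (c : 'I_N -> 'I_r) :
  generic_vectors U V -> injective h -> injective c ->
  (forall a, Z (h a) (c a)) -> \det (mxsub h c (mask Z V)) != 0.
Proof.
move=> gUV h_inj c_inj hcZ; pose P := \det (mxsub h c (mask Z (varV m s n r))).
have evP U' V' : coord_eval U' V' P = \det (mxsub h c (mask Z V')) :> K.
  by rewrite /P -det_map_mx map_mxsub map_mask coord_eval_varV.
rewrite -(evP U V); apply: (generic_transfer (L := K) (U' := 0)
  (V' := \matrix_(j, k) [exists a, (j == h a) && (k == c a)]%:R) (fun=> id) gUV).
rewrite evP (_ : mxsub _ _ _ = 1%:M) ?det1 ?oner_neq0 //.
apply/matrixP => a b; rewrite !mxE; have [<-|nab] := eqVneq a b.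
  rewrite hcZ; suff -> : [exists x, (h a == h x) && (c a == c x)] by [].
  by apply/existsP; exists a; rewrite !eqxx.
case: ifP => // _; suff -> : [exists x, (h a == h x) && (c b == c x)] = false by [].
apply/existsP => -[x /andP[/eqP/h_inj ax /eqP/c_inj bx]].
by case/eqP: nab; rewrite ax bx.
Qed.

Lemma generic_det_rowsubV (K : fieldType) m s n r (U : 'M[K]_(m, s))
    (V : 'M[K]_(n, r)) (h : 'I_r -> 'I_n) :
  generic_vectors U V -> injective h -> \det (rowsub h V) != 0.
Proof.
move=> gUV h_inj.
have := generic_det_mask (Z := fun _ _ => true) (c := id) gUV h_inj (@inj_id _) (fun=> isT).
rewrite (_ : mxsub _ _ _ = rowsub h V) //.
by apply/matrixP => a b; rewrite !mxE.
Qed.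

Lemma map_tensor_rows (R S : pzRingType) (f : {rmorphism R -> S}) m s n r N
    (U : 'M[R]_(m, s)) (V : 'M[R]_(n, r)) (e : 'I_N -> 'I_m * 'I_n) :
  map_mx f (tensor_rows U V e) = tensor_rows (map_mx f U) (map_mx f V) e.
Proof. by apply/matrixP => k c; rewrite !mxE rmorphM. Qed.

Lemma generic_spans (L K : fieldType) m s n r
    (U' : 'M[L]_(m, s)) (V' : 'M[L]_(n, r))
    (U : 'M[K]_(m, s)) (V : 'M[K]_(n, r)) (E : {set 'I_m * 'I_n}) :
  (forall z : int, z%:~R != 0 :> L -> z%:~R != 0 :> K) ->
  generic_vectors U V -> #|E| = (s * r)%N ->
  spans_at U' V' E -> spans_at U V E.
Proof.
move=> charLK gUV /enum_base[e e_inj defE].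
pose P := \det (tensor_rows (varU m s n r) (varV m s n r) e).
have evP (F : fieldType) U1 V1 : coord_eval U1 V1 P = \det (tensor_rows U1 V1 e) :> F.
  by rewrite /P -det_map_mx map_tensor_rows coord_eval_varU coord_eval_varV.
rewrite -!(tensor_rows_spans _ _ defE) -!det_mulmxr_inj -!evP.
exact: generic_transfer.
Qed.

Lemma injective_mulmxr (K : fieldType) m s (U : 'M[K]_(m, s)) (h : 'I_s -> 'I_m) p
    (C : 'M[K]_(s, p)) : \det (rowsub h U) != 0 -> U *m C = 0 -> C = 0.
Proof.
move=> dU UC; have uU : rowsub h U \in unitmx by rewrite unitmxE unitfE.
rewrite -[C]mul1mx -(mulVmx uU) -mulmxA (_ : rowsub h U *m C = 0) ?mulmx0 //.
apply/matrixP => i j; move/matrixP/(_ (h i) j): UC; rewrite !mxE => UC.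
by rewrite -[RHS]UC; apply: eq_bigr => k _; rewrite mxE.
Qed.

Lemma generic_spans_setT (K : fieldType) m s n r (U : 'M[K]_(m, s))
    (V : 'M[K]_(n, r)) : (s <= m)%N -> (r <= n)%N ->
  generic_vectors U V -> spans_at U V setT.
Proof.
move=> hs hr gUV C CT.
have wi : injective (widen_ord hs) by move=> i j []/ord_inj.
have wj : injective (widen_ord hr) by move=> i j []/ord_inj.
have UCV : U *m C *m V^T = 0.
  by apply/matrixP => i j; rewrite CT ?inE // mxE.
have : U *m C = 0.
  rewrite -[U *m C]trmxK -[in RHS]trmx0; congr _^T.
  apply: injective_mulmxr (generic_det_rowsubV gUV wj) _.
  by rewrite -[V]trmxK -trmx_mul UCV trmx0.
exact: (@injective_mulmxr _ _ _ _ (widen_ord hs) _ _ (generic_det_rowsubU gUV wi)).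
Qed.

(** Matroids are determined by their bases. Since the full set spans, every independent set lies in
    an independent set of [s * r] elements. *)
Lemma tensor_matroid_eq (K K0 : fieldType) m s n r (U : 'M[K]_(m, s))
    (V : 'M[K]_(n, r)) (U0 : 'M[K0]_(m, s)) (V0 : 'M[K0]_(n, r)) :
  spans_at U V setT -> spans_at U0 V0 setT ->
  (forall E : {set 'I_m * 'I_n}, #|E| = (s * r)%N ->
     spans_at U V E <-> spans_at U0 V0 E) ->
  tensor_matroid U V = tensor_matroid U0 V0.
Proof.
move=> spU spU0 eqE; apply: val_inj; apply/setP => A.
have sub (F : fieldType) (U1 : 'M[F]_(m, s)) (V1 : 'M[F]_(n, r)) (B : {set 'I_m * 'I_n}) :
    indep_at U1 V1 B -> A \subset B -> indep_at U1 V1 A.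
  move=> indB /subsetP sAB X XA; apply: indB => i j; apply: contraNeq => Xij.
  by apply: sAB; apply: contraNT Xij => /XA ->.
apply/idP/idP => /tensor_matroidP indA; apply/tensor_matroidP.
  have [B sAB [indB cB]] := indep_spans_ext spU indA.
  apply: sub sAB; apply/(spans_indep _ _ cB)/(eqE _ cB).
  exact/spans_indep.
have [B sAB [indB cB]] := indep_spans_ext spU0 indA.
apply: sub sAB; apply/(spans_indep _ _ cB)/(eqE _ cB).
exact/spans_indep.
Qed.

Lemma has_char_intr0 (K : fieldType) p (z : int) :
  p = 0%N \/ prime p -> has_char K p -> (z%:~R == 0 :> K) = (p %| `|z|)%N.
Proof.
rewrite /has_char => -[->|p_pr].
  move=> ch0; rewrite dvd0n absz_eq0.
  have nat0 n : (n%:R == 0 :> K) = (n == 0)%N by move: n; apply/pcharf0P.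
  by case: z => n; rewrite ?NegzE ?mulrNz ?oppr_eq0 -pmulrn nat0.
case: eqP => [p0|_ chp]; first by rewrite p0 in p_pr.
by case: z => n; rewrite ?NegzE ?mulrNz ?oppr_eq0 -pmulrn (dvdn_pcharf chp).
Qed.

(** * Merging points *)

Definition indep_rows (K : fieldType) (I T : finType) (F : I -> T -> K) :=
  forall y : I -> K, (forall c, \sum_i y i * F i c = 0) -> forall i, y i = 0.

Lemma indep_rows_det (K : fieldType) N (T : finType) (F : 'I_N -> T -> K) :
  indep_rows F <->
  exists h : 'I_N -> T, \det (\matrix_(i, j) F i (h j)) != 0.
Proof.
split=> [indF | [h /det_mulmxl_inj inj] y y0 i]; last first.
  have /rowP/(_ i) : \row_i y i = 0; last by rewrite !mxE.
  apply: inj; apply/rowP => j; rewrite !mxE -[RHS](y0 (h j)).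
  by apply: eq_bigr => k _; rewrite !mxE.
pose A := \matrix_(i, c) F i (enum_val c) : 'M_(N, #|T|).
have fA : row_full A^T.
  rewrite /row_full mxrank_tr; apply: inj_row_free => v vA.
  apply/rowP => i; rewrite mxE; apply: (indF (fun i => v 0 i)) => c.
  move/rowP/(_ (enum_rank c)): vA; rewrite !mxE => vA; rewrite -[RHS]vA.
  by apply: eq_bigr => j _; rewrite !mxE enum_rankK.
exists (fun j => enum_val (fullrankfun fA j)).
rewrite -unitfE -unitmxE -unitmx_tr (_ : _^T = rowsub (fullrankfun fA) A^T).
  exact: fullrowsub_unit.
by apply/matrixP => i j; rewrite !mxE.
Qed.

Lemma det_scale_cols (R : comPzRingType) N (u : 'I_N -> R) (A : 'M[R]_N) :
  \det (\matrix_(i, j) (u j * A i j)) = (\prod_j u j) * \det A.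
Proof.
rewrite (_ : \matrix_(i, j) _ = A *m diag_mx (\row_j u j)).
  rewrite det_mulmx det_diag mulrC; congr (_ * _).
  by apply: eq_bigr => j _; rewrite mxE.
by apply/matrixP => i j; rewrite mul_mx_diag !mxE mulrC.
Qed.

(** Each Leibniz term takes one entry from every column, so its degree is at most the sum of the
    column bounds. *)
Lemma size_det_leq (R : comNzRingType) N (M : 'M[{poly R}]_N) (d : 'I_N -> nat) :
  (forall i j, size (M i j) <= (d j).+1)%N ->
  (size (\det M) <= (\sum_j d j).+1)%N.
Proof.
move=> Md; apply: (leq_trans (size_sum _ _ _)); apply/bigmax_leqP => s _.
rewrite size_Msign.
apply: (leq_trans (size_poly_prod_leq _ _)).
rewrite leq_subLR cardT size_enum_ord addnS ltnS.
apply: (leq_trans (n := \sum_i (d (s i)).+1)); first by apply: leq_sum.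
rewrite [in leqRHS](reindex_inj (@perm_inj _ s)) /=.
under eq_bigr do rewrite -add1n.
by rewrite big_split /= sum1_card card_ord.
Qed.

Lemma infinite_nonroot (K : fieldType) (f : nat -> K) (q : {poly K}) :
  injective f -> q != 0 -> exists X, q.[X] != 0.
Proof.
move=> f_inj q0.
have [/forallP all0|] := boolP [forall n : 'I_(size q), root q (f n)].
  have := @max_poly_roots _ q (map f (iota 0 (size q))) q0.
  rewrite map_inj_uniq // iota_uniq size_map size_iota ltnn => /(_ _ isT) abs.
  have /abs // : all (root q) [seq f i | i <- iota 0 (size q)].
  apply/allP => u /mapP[n]; rewrite mem_iota => /= nq ->.
  exact: (all0 (Ordinal nq)).
by rewrite negb_forall => /existsP[n qn]; exists (f n).
Qed.

Section Merging.
Variables (T : finType) (N : nat) (a b : 'I_N -> T).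
Hypothesis ab : forall e, a e != b e.

Section Stage.
Variables (K : fieldType) (x : T -> K) (X : K) (Q : seq T).

Definition later v w := if (index v Q < index w Q)%N then w else v.

Definition pos z := if z \in Q then X else x z.

(* The points of Q have been merged, in this order, at position X.  Coordinate z
   of the differential of log (x_v - x_w) refers to dx_z while z is not merged
   and to the residue taken when z joined the cluster afterwards; the coordinate
   of the cluster itself is dropped, as translations act trivially. *)
Definition merged_col v w c : K :=
  if (v \in Q) && (w \in Q) then (c == later v w)%:R
  else if c \in Q then 0
  else ((c == v)%:R - (c == w)%:R) / (pos v - pos w).

(** The columns [inl] come from the scaling factors attached to the two ends of the edge [e], the
    columns [inr] from the difference of their positions. *)
Definition merged_row (e : 'I_N) (c : T + T) : K :=
  match c with
  | inl z => (a e == z)%:R + (b e == z)%:R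
  | inr z => merged_col (a e) (b e) z
  end.

End Stage.

Definition ordered_row (K : fieldType) (Q : seq T) (e : 'I_N) (c : T + T) : K :=
  match c with
  | inl z => (a e == z)%:R + (b e == z)%:R
  | inr z => (z == later Q (a e) (b e))%:R
  end.

(** The differential of log (t_v t_w (x_v - x_w)) for the edge from v to w, in the coordinates dlog
    t and dx. *)
Definition dlog_row (K : fieldType) (x : T -> K) (e : 'I_N) (c : T + T) : K :=
  match c with
  | inl z => (a e == z)%:R + (b e == z)%:R
  | inr z => ((z == a e)%:R - (z == b e)%:R) / (x (a e) - x (b e))
  end.

Section Poly.
Variables (K : fieldType) (x : T -> K) (Q : seq T).

(* The columns of merged_col cleared of the denominators in X: at X they give the
   configuration with Q merged, at x l the one with l merged as well. *)
Definition lin_col c d : {poly K} :=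
  if d \in Q then (-1)%:P else ('X - (x c)%:P) * ((x c - x d)^-1)%:P.

Definition poly_col v w c : {poly K} :=
  if c \in Q then
    ([&& v \in Q, w \in Q & c == later Q v w]%:R)%:P
  else if (v \in Q) && (w \in Q) then 0
  else if c == v then lin_col v w
  else if c == w then lin_col w v
  else 0.

Definition poly_row (e : 'I_N) (c : T + T) : {poly K} :=
  match c with
  | inl z => ((a e == z)%:R + (b e == z)%:R)%:P
  | inr z => poly_col (a e) (b e) z
  end.

(** The factor between a column of [poly_row] and the corresponding column of [merged_row]. The
    predicate [l] is empty at a free position [X] and singles out the point being merged otherwise;
    that column becomes a residue, with factor -1. *)
Definition col_unit (X : K) (l : pred T) (c : T + T) : K :=
  match c with
  | inl _ => 1
  | inr z => if z \in Q then 1 else if l z then -1 else X - x z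
  end.

Lemma later_mem v w : v \in Q -> w \in Q -> later Q v w \in Q.
Proof. by rewrite /later; case: ifP. Qed.

Lemma poly_row_eval (X : K) e c : (forall z, z \notin Q -> X != x z) ->
  (poly_row e c).[X] = col_unit X pred0 c * merged_row x X Q e c.
Proof.
move=> Xx; case: c => z /=; first by rewrite hornerC mul1r.
rewrite /poly_col /merged_col /pos; have eab := ab e.
move: (a e) (b e) eab => v w vw.
have [zQ|zQ] := boolP (z \in Q).
  rewrite hornerC mul1r; case: (v \in Q) => //; case: (w \in Q) => //.
have [/andP[vQ wQ]|nvw] := boolP ((v \in Q) && (w \in Q)).
  rewrite horner0 (_ : z == _ = false) ?mulr0 //.
  by apply: contraNF zQ => /eqP->; apply: later_mem.
have lin c d : c \notin Q -> (lin_col c d).[X] =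
   (X - x c) * (1 / (x c - (if d \in Q then X else x d))).
  move=> cQ; rewrite /lin_col; case: ifP => _.
    by rewrite hornerC div1r -[x c - X]opprB invrN mulrN divff // subr_eq0 Xx.
  by rewrite hornerM hornerXsubC hornerC div1r.
have [zv|zv] := eqVneq z v.
  subst z; rewrite lin // (negbTE zQ); case: eqP vw => // _ _.
  by rewrite subr0.
have [zw|zw] := eqVneq z w; last by rewrite horner0 subr0 mul0r mulr0.
subst z; rewrite lin // (negbTE zQ) sub0r.
by rewrite -[(if v \in Q then _ else _) - _]opprB invrN mulrNN.
Qed.

(** At [x l] the factor ['X - x l] in the column of [l] kills every edge that does not join [l] to
    the cluster, and the constant -1 remains for those that do. In the other columns [l] already
    sits at the position of the cluster. *)
Lemma poly_row_eval_merge l e c : l \notin Q ->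
  {in [predC Q] &, injective x} ->
  (poly_row e c).[x l] =
    col_unit (x l) (pred1 l) c * merged_row x (x l) (rcons Q l) e c.
Proof.
move=> lQ xinj; case: c => z /=; first by rewrite hornerC mul1r.
rewrite /poly_col /merged_col /pos; have eab := ab e.
move: (a e) (b e) eab => v w vw; rewrite !mem_rcons !inE.
have later_rcons : v \in Q -> w \in Q -> later (rcons Q l) v w = later Q v w.
  by rewrite /later -!cats1 !index_cat => -> ->.
have later_l u : u \in Q -> later (rcons Q l) u l = l /\ later (rcons Q l) l u = l.
  move=> uQ; rewrite /later -!cats1 !index_cat uQ (negbTE lQ) /= eqxx addn0.
  by rewrite index_mem uQ ltnNge ltnW ?index_mem.
have [zQ|zQ] := boolP (z \in Q).
  rewrite hornerC mul1r orbT.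
  case: (boolP (v \in Q)) => vQ; case: (boolP (w \in Q)) => wQ /=.
  - by rewrite !orbT later_rcons.
  - have [->|_] := eqVneq w l; last by rewrite andbF.
    rewrite orbT (later_l _ vQ).1.
    by rewrite (_ : z == l = false) //; apply: contraNF lQ => /eqP<-.
  - have [->|//] := eqVneq v l; rewrite orbT (later_l _ wQ).2.
    by rewrite (_ : z == l = false) //; apply: contraNF lQ => /eqP<-.
  - have [vl|//] := eqVneq v l; have [wl|//] := eqVneq w l.
    by rewrite vl wl eqxx in vw.
have lin c d : c \notin Q -> c != l -> (lin_col c d).[x l] =
   (x l - x c) * (1 / (x c - (if (d == l) || (d \in Q) then x l else x d))).
  move=> cQ cl; rewrite /lin_col.
  have nz : x l - x c != 0.
    by rewrite subr_eq0; apply: contra cl => /eqP/xinj->.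
  have nzK : (x l - x c) * (1 / (x c - x l)) = -1.
    by rewrite div1r -[x c - x l]opprB invrN mulrN divff.
  case: (boolP (d \in Q)) => dQ; first by rewrite orbT hornerC nzK.
  by rewrite orbF hornerM hornerXsubC hornerC div1r; case: eqP => [->|].
have [zl|zl] := eqVneq z l.
  subst z; have [vl|vl] := eqVneq v l.
    subst v; rewrite /=.
    rewrite ?(negbTE lQ) /= /lin_col ?eqxx; have [wQ|wQ] := boolP (w \in Q).
      by rewrite orbT (later_l _ wQ).2 eqxx hornerC mulr1.
    rewrite (_ : w == l = false) /=; last first.
      by apply/negbTE; rewrite eq_sym.
    by rewrite mulr0 hornerM hornerXsubC subrr mul0r.
  rewrite /=; have [wl|wl] := eqVneq w l.
    subst w; rewrite (negbTE lQ) andbF /= /lin_col andbT.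
    have [vQ|vQ] := boolP (v \in Q).
      by rewrite (later_l _ vQ).1 eqxx hornerC mulr1.
    by rewrite mulr0 hornerM hornerXsubC subrr mul0r.
  rewrite /=; case: ifP => [/andP[vQ wQ]|_]; last by rewrite horner0 mulr0.
  rewrite horner0 later_rcons // (_ : l == _ = false) ?mulr0 //.
  by apply: contraNF lQ => /eqP->; apply: later_mem.
have [/andP[vQ wQ]|nvw] := boolP ((v \in Q) && (w \in Q)).
  rewrite horner0 vQ wQ !orbT later_rcons //= (_ : z == _ = false) ?mulr0 //.
  by apply: contraNF zQ => /eqP->; apply: later_mem.
rewrite /=; have [/andP[vlQ wlQ]|_] :=
  boolP (((v == l) || (v \in Q)) && ((w == l) || (w \in Q))).
  have zv : z == v = false.
    by apply: contraTF vlQ => /eqP<-; rewrite (negbTE zl).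
  have zw : z == w = false.
    by apply: contraTF wlQ => /eqP<-; rewrite (negbTE zl).
  rewrite zv zw horner0.
  suff -> : later (rcons Q l) v w = l by rewrite (negbTE zl) mulr0.
  case/orP: vlQ => [/eqP vl|vQ]; case/orP: wlQ => [/eqP wl|wQ].
  - by rewrite vl wl eqxx in vw.
  - by rewrite vl (later_l _ wQ).2.
  - by rewrite wl (later_l _ vQ).1.
  - by rewrite vQ wQ in nvw.
have [zv|zv] := eqVneq z v.
  subst z; rewrite lin // ?(negbTE zl) ?(negbTE zQ); case: eqP vw => // _ _.
  by rewrite subr0.
have [zw|zw] := eqVneq z w; last by rewrite horner0 subr0 mul0r mulr0.
subst z; rewrite lin // ?(negbTE zl) ?(negbTE zQ) sub0r.
by rewrite -[(if (v == l) || _ then _ else _) - _]opprB invrN mulrNN.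
Qed.

Definition outer_col (c : T + T) := if c is inr z then z \notin Q else false.

Lemma size_poly_row e c : (size (poly_row e c) <= (outer_col c).+1)%N.
Proof.
case: c => z /=; first exact: size_polyC_leq1.
rewrite /poly_col; case: ifP => _ /=; first exact: size_polyC_leq1.
have szlin c d : (size (lin_col c d) <= 2)%N.
  rewrite /lin_col; case: ifP => _; first exact: leq_trans (size_polyC_leq1 _) _.
  rewrite mulrC mul_polyC; apply: (leq_trans (size_scale_leq _ _)).
  by rewrite size_XsubC.
by do 3?case: ifP => _; rewrite ?size_poly0.
Qed.

End Poly.

Lemma eq_indep_rows (K : fieldType) (I J : finType) (F G : I -> J -> K) :
  F =2 G -> indep_rows F -> indep_rows G.
Proof.
move=> FG indF y y0; apply: indF => c; rewrite -[RHS](y0 c).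
by apply: eq_bigr => i _; rewrite FG.
Qed.

Section Step.
Variables (K : fieldType) (x : T -> K) (Q : seq T).
Hypothesis xinj : {in [predC Q] &, injective x}.

Let P (h : 'I_N -> T + T) := \det (\matrix_(i, j) poly_row x Q i (h j)).

Lemma det_poly_row_eval (X : K) h : (forall z, z \notin Q -> X != x z) ->
  (P h).[X] = (\prod_j col_unit x Q X pred0 (h j)) *
              \det (\matrix_(i, j) merged_row x X Q i (h j)).
Proof.
move=> Xx; rewrite -[_.[X]]/(horner_eval X _) -det_map_mx -det_scale_cols.
by congr (\det _); apply/matrixP => i j; rewrite !mxE; apply: poly_row_eval.
Qed.

Lemma det_poly_row_eval_merge l h : l \notin Q ->
  (P h).[x l] = (\prod_j col_unit x Q (x l) (pred1 l) (h j)) *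
      \det (\matrix_(i, j) merged_row x (x l) (rcons Q l) i (h j)).
Proof.
move=> lQ; rewrite -[_.[x l]]/(horner_eval (x l) _) -det_map_mx -det_scale_cols.
by congr (\det _); apply/matrixP => i j; rewrite !mxE; apply: poly_row_eval_merge.
Qed.

(* The scaling vector field expresses the column of k through the others. *)
Lemma merged_row_drop (left : pred T) (X : K) k :
  (forall e, left (a e) && ~~ left (b e)) ->
  (forall z, z \notin Q -> X != x z) -> k \notin Q ->
  indep_rows (merged_row x X Q) ->
  indep_rows (fun e c => if c == inr k then 0 else merged_row x X Q e c).
Proof.
move=> lab Xx kQ indF y y0; apply: indF => c.
have [->{c}|/negbTE ck] := eqVneq c (inr k); last first.
  by rewrite -[RHS](y0 c) ck.
(* Every edge has exactly one left end, so adding the equations of the left vertices counts each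
   edge once. *)
have sy : \sum_e y e = 0.
  transitivity (\sum_(z | left z) \sum_e y e * merged_row x X Q e (inl z)).
    rewrite exchange_big /=; apply: eq_bigr => e _; rewrite -mulr_sumr.
    have /andP[la lb] := lab e; rewrite big_split /= (bigD1 (a e)) //= eqxx.
    rewrite !big1 ?addr0 ?mulr1 // => z.
      by move=> lz; case: eqP => // bz; rewrite bz lz in lb.
    by case/andP=> _ /negbTE; rewrite eq_sym => ->.
  by rewrite big1 // => z _; rewrite -[RHS](y0 (inl z)).
(* The weights of the scaling vector field centred at [X], with weight 1 on the residue columns. By
   homogeneity each row then has weighted sum 1, which is [rel]. *)
pose w z := if z \in Q then 1 else x z - X.
have rel e : \sum_z w z * merged_row x X Q e (inr z) = 1.
  rewrite /= /merged_col; have [/andP[aQ bQ]|nab] := boolP ((a e \in Q) && (b e \in Q)).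
    have lQ := later_mem aQ bQ; rewrite (bigD1 (later Q (a e) (b e))) //= eqxx.
    rewrite big1 ?addr0 ?mulr1 ?/w ?lQ // => z /negbTE->; exact: mulr0.
  have nz : pos x X Q (a e) - pos x X Q (b e) != 0.
    rewrite subr_eq0 /pos.
    case: (boolP (a e \in Q)) nab => aQ; case: (boolP (b e \in Q)) => bQ //= _.
    - exact: Xx.
    - by rewrite eq_sym Xx.
    - by apply: contra (ab e) => /eqP/xinj->.
  have posw z : (if z \in Q then 0 else w z) = pos x X Q z - X.
    by rewrite /w /pos; case: (z \in Q); rewrite ?subrr.
  transitivity (\sum_z (pos x X Q z - X) * (((z == a e)%:R - (z == b e)%:R) /
        (pos x X Q (a e) - pos x X Q (b e)))).
    apply: eq_bigr => z _; rewrite -posw; case: ifP => _; last by [].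
    by rewrite mulr0 mul0r.
  transitivity ((pos x X Q (a e) - X - (pos x X Q (b e) - X)) /
        (pos x X Q (a e) - pos x X Q (b e))); last first.
    by rewrite opprB addrA addrNK divff.
  have sel u : \sum_z (pos x X Q z - X) * (z == u)%:R = pos x X Q u - X.
    rewrite (bigD1 u) //= eqxx mulr1 big1 ?addr0 // => z /negbTE->.
    exact: mulr0.
  rewrite -(sel (a e)) -(sel (b e)) -sumrB mulr_suml.
  by apply: eq_bigr => z _; rewrite mulrA mulrBr.
have : w k * \sum_e y e * merged_row x X Q e (inr k) = 0.
  rewrite -[RHS]sy; transitivity
    (\sum_z w z * \sum_e y e * merged_row x X Q e (inr z)).
    rewrite [RHS](bigD1 k) //= [X in _ + X]big1 ?addr0 // => z zk.
    have := y0 (inr z); rewrite (inj_eq (@inr_inj _ _)) (negbTE zk) => ->.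
    exact: mulr0.
  under eq_bigr do rewrite mulr_sumr.
  rewrite exchange_big /=; apply: eq_bigr => e _.
  rewrite -[RHS]mulr1 -(rel e) mulr_sumr; apply: eq_bigr => z _.
  by rewrite mulrCA.
move/eqP; rewrite mulf_eq0 /w (negbTE kQ) subr_eq0 eq_sym (negbTE (Xx _ kQ)).
by move/eqP.
Qed.

(* A nonzero minor avoiding the column of k has degree less than the number of
   unmerged points, so it cannot vanish at all of them. *)
Lemma merge_forward (left : pred T) (X : K) k :
  (forall e, left (a e) && ~~ left (b e)) ->
  (forall z, z \notin Q -> X != x z) -> k \notin Q ->
  indep_rows (merged_row x X Q) ->
  exists2 l, l \notin Q & indep_rows (merged_row x (x l) (rcons Q l)).
Proof.
move=> lab Xx kQ /(merged_row_drop lab Xx kQ)/indep_rows_det[h dh].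
have h_k j : h j != inr k.
  apply: contraNneq dh => hk; apply/eqP; rewrite -det_tr.
  rewrite (expand_det_row _ j) big1 // => i _.
  by rewrite !mxE hk eqxx mul0r.
have h_inj : injective h.
  move=> i j hij; apply/eqP; apply: contraNT dh => nij.
  rewrite -det_tr; apply/eqP; apply: (determinant_alternate nij) => e.
  by rewrite !mxE hij.
have PX : (P h).[X] != 0.
  rewrite det_poly_row_eval // mulf_neq0 //.
    apply/prodf_neq0 => j _; rewrite /col_unit; case: (h j) => [z|z].
      exact: oner_neq0.
    by case: ifP => [_|/negbT zQ]; rewrite ?oner_neq0 // subr_eq0 Xx.
  congr (\det _ != 0): dh; apply/matrixP => i j.
  by rewrite !mxE (negbTE (h_k j)).
have [/existsP[l /andP[lQ Pl]]|] := boolP [exists l, (l \notin Q) && ((P h).[x l] != 0)].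
  exists l => //; apply/indep_rows_det; exists h.
  by move: Pl; rewrite det_poly_row_eval_merge // mulf_eq0 => /norP[].
rewrite negb_exists => /forallP Pl0.
have P0 : P h != 0 by apply: contraNneq PX => ->; rewrite horner0.
pose rs := [seq x l | l <- enum [predC Q]].
have urs : uniq rs.
  rewrite map_inj_in_uniq ?enum_uniq // => u v.
  by rewrite !mem_enum => uQ vQ; apply: xinj.
have rrs : all (root (P h)) rs.
  apply/allP => _ /mapP[l lQ ->]; rewrite mem_enum inE /= in lQ.
  by have := Pl0 l; rewrite lQ /= negbK rootE.
have := max_poly_roots P0 rrs urs; rewrite ltnNge => /negP[].
have dP : (size (P h) <= (\sum_j outer_col Q (h j)).+1)%N.
  by apply: size_det_leq => i j; rewrite mxE; apply: size_poly_row.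
(* The degree is at most the number of outer columns in the minor. These are distinct and avoid the
   column of [k], so there are fewer of them than unmerged points. *)
apply: (leq_trans dP); rewrite size_map -cardE (cardD1 k) inE kQ ltnS.
pose D := [set j | outer_col Q (h j)].
have -> : (\sum_j outer_col Q (h j) = #|D|)%N.
  by rewrite -sum1_card [RHS]big_mkcond /=; apply: eq_bigr => j _; rewrite inE; case: (outer_col _ _).
rewrite -(card_imset _ h_inj) -(card_image (@inr_inj T T) [predD1 [predC Q] & k]).
apply: subset_leq_card; apply/subsetP => _ /imsetP[j + ->]; rewrite inE.
have := h_k j; case: (h j) => // z zk zQ; apply/imageP; exists z => //.
rewrite !inE; apply/andP; split; last exact: zQ.
by rewrite -(inj_eq (@inr_inj T T)).
Qed.

(** The minor is a polynomial in the position of the cluster that is nonzero at [x l], so over an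
    infinite field it is also nonzero at some position distinct from all unmerged points. *)
Lemma merge_backward (f : nat -> K) l : injective f -> l \notin Q ->
  indep_rows (merged_row x (x l) (rcons Q l)) ->
  exists2 X, forall z, z \notin Q -> X != x z & indep_rows (merged_row x X Q).
Proof.
move=> f_inj lQ /indep_rows_det[h dh].
have Pl : (P h).[x l] != 0.
  rewrite det_poly_row_eval_merge // mulf_neq0 //.
  apply/prodf_neq0 => j _; rewrite /col_unit; case: (h j) => [z|z].
    exact: oner_neq0.
  case: ifP => [_|/negbT zQ]; rewrite ?oner_neq0 //=.
  have [//|zl] := eqVneq z l; first by rewrite oppr_eq0 oner_neq0.
  by rewrite subr_eq0; apply: contra zl => /eqP/xinj->.
have P0 : P h != 0 by apply: contraNneq Pl => ->; rewrite horner0.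
pose q := P h * \prod_(z | z \notin Q) ('X - (x z)%:P).
have q0 : q != 0.
  by rewrite mulf_neq0 //; apply/prodf_neq0 => z _; rewrite polyXsubC_eq0.
have [X] := infinite_nonroot f_inj q0.
rewrite hornerM mulf_eq0 negb_or horner_prod => /andP[PX Xn].
have Xx z : z \notin Q -> X != x z.
  by move=> zQ; move/prodf_neq0/(_ z zQ): Xn; rewrite hornerXsubC subr_eq0.
exists X => //; apply/indep_rows_det; exists h.
by move: PX; rewrite det_poly_row_eval // mulf_eq0 => /norP[].
Qed.

End Step.

Lemma merged_row_full (K : fieldType) (x : T -> K) X Q :
  (forall z, z \in Q) -> merged_row x X Q =2 ordered_row K Q.
Proof. by move=> Qf e [z|z] //=; rewrite /merged_col !Qf. Qed.

Lemma dlog_ordered (K : fieldType) (x : T -> K) (left : pred T) (o : T) :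
  (forall e, left (a e) && ~~ left (b e)) -> injective x ->
  indep_rows (dlog_row x) ->
  exists Q, [/\ uniq Q, Q != [::], forall z, z \in Q & indep_rows (ordered_row K Q)].
Proof.
move=> lab xinj indx.
(* A cluster of one point only loses the column of [o], which is minus the sum of the other [inr]
   columns by translation invariance. *)
have base : indep_rows (merged_row x (x o) [:: o]).
  move=> y y0; apply: indx => -[z|z]; first by rewrite -[RHS](y0 (inl z)).
  have row_eq e u : u != o ->
      merged_row x (x o) [:: o] e (inr u) = dlog_row x e (inr u).
    have posE v : pos x (x o) [:: o] v = x v.
      by rewrite /pos inE; case: eqP => [->|].
    move=> /negbTE uo; rewrite /= /merged_col !posE !inE uo.
    have -> : (a e == o) && (b e == o) = false.
      by apply/negbTE; apply: contra (ab e) => /andP[/eqP-> /eqP->].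
    by [].
  have [->{z}|zo] := eqVneq z o; last first.
    by rewrite -[RHS](y0 (inr z)); apply: eq_bigr => e _; rewrite row_eq.
  have : \sum_z \sum_e y e * dlog_row x e (inr z) = 0.
    rewrite exchange_big /= big1 // => e _; rewrite -mulr_sumr -mulr_suml.
    have sel u : \sum_z (z == u)%:R = 1 :> K.
      by rewrite (bigD1 u) //= eqxx big1 ?addr0 // => z /negbTE->.
    by rewrite sumrB !sel subrr mul0r mulr0.
  rewrite (bigD1 o) //= [X in _ + X]big1 ?addr0 // => z zo.
  by rewrite -[RHS](y0 (inr z)); apply: eq_bigr => e _; rewrite row_eq.
have main n : forall Q X, #|[predC Q]| = n -> uniq Q -> Q != [::] ->
    (forall z, z \notin Q -> X != x z) -> indep_rows (merged_row x X Q) ->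
    exists Q, [/\ uniq Q, Q != [::], forall z, z \in Q & indep_rows (ordered_row K Q)].
  elim: n => [|n IHn] Q X cQ uQ Q0 Xx indQ.
    have Qf z : z \in Q by move/card0_eq/(_ z): cQ; rewrite inE /= => /negbFE.
    exists Q; split=> //; exact: eq_indep_rows (merged_row_full _ _ Qf) indQ.
  have [k kQ] : exists k, k \in [predC Q] by apply/card_gt0P; rewrite cQ.
  have [l lQ indl] := merge_forward (in2W xinj) lab Xx kQ indQ.
  apply: IHn indl.
  - move: cQ; rewrite (cardD1 l) inE /= lQ => -[<-]; apply: eq_card => z.
    by rewrite !inE mem_rcons inE negb_or.
  - by rewrite rcons_uniq lQ.
  - by case: (Q).
  - move=> z; rewrite mem_rcons inE negb_or => /andP[zl _].
    by rewrite (inj_eq xinj) eq_sym.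
apply: main base => // z; rewrite inE => zo.
by rewrite (inj_eq xinj) eq_sym.
Qed.

Lemma ordered_dlog (K : fieldType) (f : nat -> K) Q : injective f ->
  uniq Q -> Q != [::] -> (forall z, z \in Q) -> indep_rows (ordered_row K Q) ->
  exists2 x : T -> K, injective x & indep_rows (dlog_row x).
Proof.
move=> f_inj uQ Q0 Qf indQ.
(* The positions are generalised so that induction can detach points from the end of [Q]. When all
   points are merged there is no constraint on [x] and [X], and zero will do. *)
suff main (x : T -> K) X : {in [predC Q] &, injective x} ->
    (forall z, z \notin Q -> X != x z) -> indep_rows (merged_row x X Q) ->
    exists2 x : T -> K, injective x & indep_rows (dlog_row x).
  apply: (main (fun=> 0) 0).
  - by move=> z z'; rewrite inE /= Qf.
  - by move=> z; rewrite Qf.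
  - by apply: eq_indep_rows indQ => e c; rewrite merged_row_full.
move=> {indQ Qf}; elim/last_ind: Q uQ Q0 x X => // Q l IHQ + _ x X.
rewrite rcons_uniq => /andP[lQ uQ] xinj Xx indl.
(* Placing [l] at the position of the cluster changes no row while [l] is merged, and it makes [X]
   the value [x1 l] at which the minor is evaluated. *)
pose x1 := [eta x with l |-> X].
have x1inj : {in [predC Q] &, injective x1}.
  move=> u v; rewrite !inE /= => uQ' vQ'.
  case: eqP => [->|/eqP ul]; case: eqP => [->|/eqP vl] //= e.
  - have := Xx v; rewrite mem_rcons inE negb_or vl vQ' e eqxx => /(_ isT).
    by [].
  - have := Xx u; rewrite mem_rcons inE negb_or ul uQ' e eqxx => /(_ isT).
    by [].
  - by apply: xinj => //; rewrite inE /= mem_rcons inE negb_or ?ul ?vl ?uQ' ?vQ'.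
have indl1 : indep_rows (merged_row x1 (x1 l) (rcons Q l)).
  apply: eq_indep_rows indl => e [z|z] //=; rewrite eqxx /merged_col /pos.
  have x1E u : (if u \in rcons Q l then X else x1 u) =
               (if u \in rcons Q l then X else x u).
    by case: ifP => //; rewrite mem_rcons inE /= => /norP[/negbTE-> _].
  by rewrite !x1E.
have [Q0|Q0] := eqVneq Q [::]; last first.
  have [X' X'x indQ] := merge_backward x1inj f_inj lQ indl1.
  exact: IHQ uQ Q0 _ _ x1inj X'x indQ.
(* Only [l] is left in the cluster, so the merged rows are the dlog rows with the column of [l] set
   to zero, and independence passes to the larger set of columns. *)
subst Q; exists x1 => [u v|y y0]; first exact: x1inj.
apply: indl1 => -[z|z]; first by rewrite -[RHS](y0 (inl z)).
rewrite -[RHS](mulr0 (z != l)%:R) -[in RHS](y0 (inr z)) mulr_sumr; apply: eq_bigr => e _.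
rewrite mulrCA; congr (_ * _).
have posE z' : pos x1 (x1 l) [:: l] z' = x1 z'.
  by rewrite /pos inE; case: eqP => [->|].
rewrite /rcons /merged_row /merged_col !posE !inE.
have -> : (a e == l) && (b e == l) = false.
  by apply/negbTE; apply: contra (ab e) => /andP[/eqP-> /eqP->].
case: eqP => _; first by rewrite mul0r.
by rewrite mul1r.
Qed.

End Merging.

Definition bipartite_row (K : fieldType) (T I : finType) (p q : I -> T)
    (e : I) (c : T + T) : K :=
  match c with inl z => (p e == z)%:R | inr z => (q e == z)%:R end.

(** Every nonempty fibre over the image of [S] has at least two elements. *)
Lemma card_imset_half (T I : finType) (p : I -> T) (S : {set I}) :
  (forall z, #|[set e in S | p e == z]| != 1%N) -> (2 * #|p @: S| <= #|S|)%N.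
Proof.
move=> fib; rewrite -[#|S|]sum1_card (partition_big_imset p) /=.
rewrite mulnC -sum_nat_const; apply: leq_sum => _ /imsetP[e eS ->].
rewrite sum1dep_card; have := fib (p e).
case E: #|_| => [|[|n]] // _.
by move/eqP: E; rewrite cards_eq0 => /eqP/setP/(_ e); rewrite !inE eS eqxx.
Qed.

(* Without leaves there are at least as many edges as vertices, but the vertex
   equations are dependent since both sides sum to the total weight. *)
Lemma bipartite_rows_leaf (K : fieldType) (T I : finType) (p q : I -> T)
    (S : {set I}) : indep_rows (bipartite_row K p q) -> S != set0 ->
  exists z, (#|[set e in S | p e == z]| == 1%N) || (#|[set e in S | q e == z]| == 1%N).
Proof.
move=> indR /set0Pn[e0 e0S]; apply/existsP; apply: contraT.
rewrite negb_exists => /forallP nleaf.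
have hp : (2 * #|p @: S| <= #|S|)%N.
  by apply: card_imset_half => z; have := nleaf z; rewrite negb_or => /andP[].
have hq : (2 * #|q @: S| <= #|S|)%N.
  by apply: card_imset_half => z; have := nleaf z; rewrite negb_or => /andP[].
(* The vertices touched by [S] except one on the right. This leaves fewer equations than edges,
   hence a nonzero solution [y]. *)
pose C : {set T + T} := (inl @: (p @: S)) :|: (inr @: ((q @: S) :\ q e0)).
have cC : (#|C| < #|S|)%N.
  have e0q : q e0 \in q @: S by apply: imset_f.
  apply: (leq_ltn_trans (leq_card_setU _ _)).
  rewrite (card_imset _ (@inl_inj T T)) (card_imset _ (@inr_inj T T)).
  by move: hp hq; rewrite (cardsD1 (q e0) (q @: S)) e0q; lia.
pose A := \matrix_(i, c) bipartite_row K p q (enum_val i) (enum_val c) : 'M_(#|S|, #|C|).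
have nfree : ~~ row_free A.
  by rewrite /row_free neq_ltn (leq_ltn_trans (rank_leq_col _) cC).
pose v := nz_row (kermx A).
have v0 : v != 0 by rewrite nz_row_eq0 kermx_eq0.
have vA : v *m A = 0 by apply/sub_kermxP; apply: nz_row_sub.
pose y e := if e \in S then v 0 (enum_rank_in e0S e) else 0.
have yC c : c \in C -> \sum_e y e * bipartite_row K p q e c = 0.
  move=> cC'; move/rowP/(_ (enum_rank_in cC' c)): vA; rewrite !mxE => vA.
  rewrite -[RHS]vA (bigID [pred x | x \in S]) /= [X in _ + X]big1 ?addr0; last first.
    by move=> e /negbTE eS; rewrite /y eS mul0r.
  rewrite big_enum_val; apply: eq_bigr => i _.
  by rewrite !mxE enum_rankK_in // /y enum_valP enum_valK_in.
have yp z : \sum_e y e * (p e == z)%:R = 0.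
  have [zS|zS] := boolP (z \in p @: S).
    by have := yC (inl z); apply; rewrite inE imset_f.
  rewrite big1 // => e _; rewrite /y; case: ifP => eS; last exact: mul0r.
  case: eqP => [ez|_]; last exact: mulr0.
  by rewrite -ez imset_f in zS.
have sy : \sum_e y e = 0.
  transitivity (\sum_z \sum_e y e * (p e == z)%:R); last by apply: big1.
  rewrite exchange_big; apply: eq_bigr => e _; rewrite -mulr_sumr.
  rewrite (bigD1 (p e)) //= eqxx big1 ?addr0 ?mulr1 // => z /negbTE.
  by rewrite eq_sym => ->.
have yq z : z != q e0 -> \sum_e y e * (q e == z)%:R = 0.
  move=> zq; have [zS|zS] := boolP (z \in q @: S).
    by have := yC (inr z); apply; rewrite inE [X in _ || X]imset_f ?orbT // !inE zq.
  rewrite big1 // => e _; rewrite /y; case: ifP => eS; last exact: mul0r.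
  case: eqP => [ez|_]; last exact: mulr0.
  by rewrite -ez imset_f in zS.
have y0 c : \sum_e y e * bipartite_row K p q e c = 0.
  case: c => z; first exact: yp.
  have [->|] := eqVneq z (q e0); last exact: yq.
  rewrite -[RHS]sy; apply/esym.
  transitivity (\sum_z \sum_e y e * (q e == z)%:R).
    rewrite exchange_big; apply: eq_bigr => e _; rewrite -mulr_sumr.
    rewrite (bigD1 (q e)) //= eqxx big1 ?addr0 ?mulr1 // => u /negbTE.
    by rewrite eq_sym => ->.
  by rewrite (bigD1 (q e0)) //= [X in _ + X]big1 ?addr0 // => u; apply: yq.
have yz := indR y y0.
case/negP: v0; apply/eqP/rowP => i; rewrite mxE -(yz (enum_val i)).
by rewrite /y enum_valP enum_valK_in.
Qed.

(** The support of a relation over [K] has no leaf, because the equation at a leaf has a single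
    nonzero term. Independence over [K0] gives every nonempty set of edges a leaf. *)
Lemma bipartite_rows_transfer (K0 K : fieldType) (T I : finType) (p q : I -> T) :
  indep_rows (bipartite_row K0 p q) -> indep_rows (bipartite_row K p q).
Proof.
move=> ind0 y y0 e; apply/eqP; apply: contraT => ye.
pose S := [set e | y e != 0].
have S0 : S != set0 by apply/set0Pn; exists e; rewrite inE.
have leaf (h : I -> T) z : \sum_e y e * (h e == z)%:R = 0 ->
    #|[set e in S | h e == z]| != 1%N.
  move=> yz; apply/cards1P => -[e1 /setP Se1].
  have := Se1 e1; rewrite !inE eqxx => /andP[ye1 he1]; case/negP: ye1.
  move: yz; rewrite (bigD1 e1) //= he1 mulr1 big1 ?addr0 => [-> //|e2 ne].
  have := Se1 e2; rewrite !inE (negbTE ne) => /negbT; rewrite negb_and negbK.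
  by case/orP=> [/eqP->|/negbTE->]; rewrite ?mul0r ?mulr0.
have [z] := bipartite_rows_leaf ind0 S0.
by rewrite (negbTE (leaf _ _ (y0 (inl z)))) (negbTE (leaf _ _ (y0 (inr z)))).
Qed.

(** The [inr] columns record the later end of each edge; subtracting them from the [inl] columns
    leaves the earlier end. This is the incidence matrix of a bipartite graph with one copy of the
    vertices for later and one for earlier ends. *)
Lemma ordered_row_transfer (K0 K : fieldType) (T : finType) N (a b : 'I_N -> T) Q :
  indep_rows (ordered_row a b K0 Q) -> indep_rows (ordered_row a b K Q).
Proof.
pose p e := later Q (a e) (b e).
pose q e := if (index (a e) Q < index (b e) Q)%N then a e else b e.
have pq (F : fieldType) e z : (a e == z)%:R + (b e == z)%:R =
    (p e == z)%:R + (q e == z)%:R :> F.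
  by rewrite /p /q /later; case: ifP; rewrite // addrC.
move=> ind0.
have : indep_rows (fun e (c : T + T) =>
    match c with inl z => (p e == z)%:R | inr z => (q e == z)%:R end : K0).
  move=> y y0; apply: ind0 => -[z|z] /=; last first.
    by rewrite -[RHS](y0 (inl z)); apply: eq_bigr => e _; rewrite eq_sym.
  transitivity (\sum_i y i * (p i == z)%:R + \sum_i y i * (q i == z)%:R).
    rewrite -big_split /=.
    by apply: eq_bigr => e _; rewrite pq mulrDr.
  by rewrite (y0 (inl z)) (y0 (inr z)) addr0.
move/(@bipartite_rows_transfer K0 K) => ind1 y y0; apply: ind1.
have yp z : \sum_i y i * (p i == z)%:R = 0.
  by rewrite -[RHS](y0 (inr z)); apply: eq_bigr => e _; rewrite eq_sym.
move=> [z|z]; rewrite ?yp //.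
suff : \sum_i y i * (p i == z)%:R + \sum_i y i * (q i == z)%:R = 0.
  by rewrite yp add0r.
rewrite -[RHS](y0 (inl z)) -big_split /=.
by apply: eq_bigr => e _; rewrite pq mulrDr.
Qed.

(** * Duality in corank two *)

Lemma left_kernel_basis (K : fieldType) m a s (A : 'M[K]_(m, a)) :
  (\rank A + s <= m)%N -> exists2 B : 'M[K]_(s, m), row_free B & B *m A = 0.
Proof.
move=> rA; pose W := row_base (kermx A).
exists ((pid_mx s : 'M_(s, _)) *m W).
  rewrite /row_free mxrankMfree ?row_base_free // rank_pid_mx ?mxrank_ker //.
  by rewrite leq_subRL ?rank_leq_row.
rewrite -mulmxA (_ : W *m A = 0) ?mulmx0 //.
by apply/sub_kermxP; rewrite eq_row_base.
Qed.

(** The rows of [N] form a basis of the left kernel of [A], and a dimension count shows that these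
    equations cut out exactly the column space. *)
Lemma column_space_equations (K : fieldType) m s a (A : 'M[K]_(m, s)) :
  m = (s + a)%N -> \rank A = s ->
  exists2 N : 'M[K]_(a, m), row_free N /\ N *m A = 0 &
    forall p (X : 'M[K]_(m, p)), N *m X = 0 -> exists C, X = A *m C.
Proof.
move=> ms rA; have [N Nfree NA] : exists2 N : 'M[K]_(a, m), row_free N & N *m A = 0.
  by apply: left_kernel_basis; rewrite rA ms.
exists N => // p X NX.
have sA : (A^T <= kermx N^T)%MS by apply/sub_kermxP; rewrite -trmx_mul NA trmx0.
have : (X^T <= A^T)%MS.
  have sX : (X^T <= kermx N^T)%MS by apply/sub_kermxP; rewrite -trmx_mul NX trmx0.
  apply: submx_trans sX _; have [_ <-] := mxrank_leqif_sup sA.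
  by rewrite mxrank_ker !mxrank_tr rA (eqP Nfree) ms addnK.
by case/submxP=> D XD; exists D^T; rewrite -[X]trmxK XD trmx_mul trmxK.
Qed.

Lemma rank_det_rowsub (K : fieldType) m s (A : 'M[K]_(m, s)) (h : 'I_s -> 'I_m) :
  \det (rowsub h A) != 0 -> \rank A = s.
Proof.
move=> dA; apply/eqP; rewrite -mxrank_tr; apply: inj_row_free => v vA.
by rewrite -[v]trmxK (injective_mulmxr (C := v^T) dA) ?trmx0 // -[A]trmxK -trmx_mul vA trmx0.
Qed.

(** The left kernel of [A] is given by two rows, and its [m] columns are pairwise independent
    because all maximal minors of [A] are nonzero. A combination of the two rows with no zero entry
    gives [rho], and the ratios to it are distinct points [al] of the affine line. *)
Lemma kernel_points (K : fieldType) (f : nat -> K) m s (A : 'M[K]_(m, s)) :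
  injective f -> m = (s + 2)%N ->
  (forall h : 'I_s -> 'I_m, injective h -> \det (rowsub h A) != 0) ->
  exists rho al : 'I_m -> K,
    [/\ forall i, rho i != 0, injective al &
        forall p (X : 'M[K]_(m, p)),
          (forall j, \sum_i X i j * rho i = 0) ->
          (forall j, \sum_i X i j * rho i * al i = 0) ->
          exists C, X = A *m C].
Proof.
move=> f_inj ms detA.
have Ainj p (C : 'M[K]_(s, p)) (h : 'I_s -> 'I_m) : injective h ->
    (forall i j, (A *m C) (h i) j = 0) -> C = 0.
  move=> h_inj AC; apply: (@injective_mulmxr _ _ _ (rowsub h A) id).
    by rewrite -rowsub_comp detA.
  by apply/matrixP => i j; rewrite mul_rowsub_mx mxE AC mxE.
have sm : (s <= m)%N by rewrite ms leq_addr.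
have wi : injective (widen_ord sm) by move=> i j []/ord_inj.
have rA := rank_det_rowsub (detA _ wi).
have [N [Nfree NA] kerN] := column_space_equations ms rA.
(* A vector of the column space that vanishes outside two rows vanishes on [s] rows of [A], so it is
   zero. *)
have two i1 i2 (w : 'cV[K]_m) : i1 != i2 ->
    (forall i, i != i1 -> i != i2 -> w i 0 = 0) -> N *m w = 0 -> w = 0.
  move=> ni w0 /kerN[C wC].
  have [h h_inj hE] : exists2 h : 'I_s -> 'I_m, injective h & ~: [set i1; i2] = [set h k | k : 'I_s].
    by apply: enum_base; rewrite cardsCs setCK cards2 ni card_ord ms addnK.
  rewrite wC (Ainj _ C h) ?mulmx0 // => i j; rewrite -wC ord1.
  have : h i \in ~: [set i1; i2] by rewrite hE imset_f.
  by rewrite !inE negb_or => /andP[]; apply: w0.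
(* The value at [t] is entry [i] of the combination of the two rows with coefficients [t] and 1; [t]
   is chosen to avoid all zeros. *)
pose p (i : 'I_m) : {poly K} := N 0 i *: 'X + (N 1 i)%:P.
have p0 i : p i != 0.
  apply/eqP => pi0.
  have N0 : N 0 i = 0.
    have := congr1 (fun q : {poly K} => q`_1) pi0.
    by rewrite /p coefD coefZ coefX coefC coef0 /= mulr1 addr0.
  have N1 : N 1 i = 0.
    have := congr1 (fun q : {poly K} => q`_0) pi0.
    by rewrite /p coefD coefZ coefX coefC coef0 /= mulr0 add0r.
  have [i' ni] : exists i', i != i'.
    have : (0 < #|[set~ i]|)%N by rewrite cardsC1 card_ord ms addn2.
    by case/card_gt0P => i'; rewrite !inE eq_sym; exists i'.
  have /colP/(_ i) : \col_k (k == i)%:R = 0 :> 'cV[K]_m.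
    apply: (two i i') => // [k /negbTE ki _|]; first by rewrite mxE ki.
    apply/colP => k; rewrite !mxE (bigD1 i) //= big1 ?addr0 ?mxE ?eqxx ?mulr1.
      by case: k => -[|[|//]] kP; [rewrite -[RHS]N0|rewrite -[RHS]N1];
         congr (N _ _); apply: val_inj.
    by move=> k' /negbTE ki; rewrite mxE ki mulr0.
  by rewrite !mxE eqxx => /eqP; rewrite oner_eq0.
have [t] : exists t, (\prod_i p i).[t] != 0.
  by apply: infinite_nonroot f_inj _; apply/prodf_neq0.
rewrite horner_prod => /prodf_neq0 rho0.
pose rho i := (p i).[t].
have rhoE i : rho i = N 0 i * t + N 1 i by rewrite /rho /p !hornerE.
exists rho, (fun i => N 0 i / rho i); split=> [i||q X X1 X0]; first exact: rho0.
  move=> i i' e; apply/eqP; apply: contraT => ni.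
  have r0 : rho i != 0 by apply: rho0.
  have r0' : rho i' != 0 by apply: rho0.
  have E0 : rho i' * N 0 i = rho i * N 0 i'.
    have := congr1 (fun z => z * (rho i * rho i')) e.
    by rewrite mulrA divfK // [rho i * rho i']mulrC mulrA divfK // mulrC => ->; rewrite mulrC.
  have E1 : rho i' * N 1 i = rho i * N 1 i'.
    have -> : N 1 i = rho i - N 0 i * t by rewrite rhoE [N 0 i * t + _]addrC addrK.
    have -> : N 1 i' = rho i' - N 0 i' * t by rewrite rhoE [N 0 i' * t + _]addrC addrK.
    by rewrite !mulrBr !mulrA E0 mulrC.
  have /colP/(_ i) : \col_k (rho i' * (k == i)%:R - rho i * (k == i')%:R) = 0 :> 'cV[K]_m.
    apply: (two i i') => // [k /negbTE ki /negbTE ki'|].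
      by rewrite mxE ki ki' !mulr0 subrr.
    have sel k u : \sum_j N k j * (j == u)%:R = N k u.
      rewrite (bigD1 u) //= eqxx mulr1 big1 ?addr0 // => j /negbTE->.
      exact: mulr0.
    apply/colP => k; rewrite !mxE.
    transitivity (rho i' * N k i - rho i * N k i').
      rewrite -(sel k i) -(sel k i') !mulr_sumr -sumrB.
      by apply: eq_bigr => j _; rewrite mxE mulrBr mulrCA [in X in _ - X]mulrCA.
    apply/eqP; rewrite subr_eq0; apply/eqP.
    case: k => -[|[|//]] kP.
      by rewrite (_ : Ordinal kP = 0) //; apply: val_inj.
    by rewrite (_ : Ordinal kP = 1) //; apply: val_inj.
  rewrite !mxE eqxx (negbTE ni) mulr0 subr0 mulr1 => /eqP.
  by rewrite (negbTE r0').
apply: kerN; apply/matrixP => k j; rewrite !mxE.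
have N0 : \sum_i N 0 i * X i j = 0.
  rewrite -[RHS](X0 j); apply: eq_bigr => i _.
  by rewrite [RHS]mulrAC -mulrA divfK ?rho0 // mulrC.
have N1 : \sum_i N 1 i * X i j = 0.
  rewrite -[RHS](X1 j) -[LHS]addr0 -[X in _ + X](mulr0 t) -[X in _ * X]N0.
  rewrite mulr_sumr -big_split /=; apply: eq_bigr => i _.
  by rewrite rhoE mulrA -mulrDl [X i j * _]mulrC addrC [t * _]mulrC.
case: k => -[|[|//]] kP.
  by rewrite -[RHS]N0; apply: eq_bigr => i _; congr (N _ _ * _); apply: val_inj.
by rewrite -[RHS]N1; apply: eq_bigr => i _; congr (N _ _ * _); apply: val_inj.
Qed.

Lemma points_kernel (K : fieldType) m s (x : 'I_m -> K) : m = (s + 2)%N ->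
  exists A : 'M[K]_(m, s),
    [/\ forall p (C : 'M[K]_(s, p)), A *m C = 0 -> C = 0,
        forall k, \sum_i A i k = 0 & forall k, \sum_i A i k * x i = 0].
Proof.
move=> ms; pose P : 'M[K]_(m, 2) := \matrix_(i, k) if k == 0 then x i else 1.
have [B Bfree BP] : exists2 B : 'M[K]_(s, m), row_free B & B *m P = 0.
  by apply: left_kernel_basis; rewrite [leqRHS]ms addnC leq_add2l rank_leq_col.
exists B^T; split=> [p C BC|k|k].
- apply/trmx_inj/(row_free_inj Bfree).
  by rewrite /= -[B]trmxK -trmx_mul BC !trmx0 mul0mx.
- move/matrixP/(_ k 1): BP; rewrite !mxE => BP; rewrite -[RHS]BP.
  by apply: eq_bigr => i _; rewrite !mxE mulr1.
- move/matrixP/(_ k 0): BP; rewrite !mxE => BP; rewrite -[RHS]BP.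
  by apply: eq_bigr => i _; rewrite !mxE.
Qed.

Section TwoTwo.
Variables (m n N : nat) (e : 'I_N -> 'I_m * 'I_n) (F : {set 'I_m * 'I_n}).
Hypotheses (e_inj : injective e) (defF : F = [set e k | k : 'I_N]).

(** The elements of [F], the complement of a basis, are read as edges of a bipartite graph whose
    vertices are the rows and the columns. *)
Let a k : 'I_m + 'I_n := inl (e k).1.
Let b k : 'I_m + 'I_n := inr (e k).2.

Lemma sum_edges (K : fieldType) (Y : 'I_m -> 'I_n -> K) :
  (forall i j, (i, j) \notin F -> Y i j = 0) ->
  \sum_k Y (e k).1 (e k).2 = \sum_i \sum_j Y i j.
Proof.
move=> YF; rewrite pair_big /= (bigID [pred u | u \in F]) /=.
rewrite [X in _ + X]big1 ?addr0 => [|[i j] /YF //].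
by rewrite defF big_imset //= => ? ? _ _; apply: e_inj.
Qed.

Lemma extend_edges (K : fieldType) (y : 'I_N -> K) :
  exists2 Y : 'I_m -> 'I_n -> K, forall i j, (i, j) \notin F -> Y i j = 0 &
    forall k, Y (e k).1 (e k).2 = y k.
Proof.
exists (fun i j => if [pick k | e k == (i, j)] is Some k then y k else 0).
  move=> i j nF; case: pickP => // k /eqP ek.
  by case/negP: nF; rewrite defF -ek imset_f.
move=> k; rewrite -surjective_pairing; case: pickP => [k' /eqP/e_inj-> //|].
by move/(_ k); rewrite eqxx.
Qed.

Lemma dlog_rowsP (K : fieldType) (x : 'I_m + 'I_n -> K) (Y : 'I_m -> 'I_n -> K) :
  (forall i j, (i, j) \notin F -> Y i j = 0) ->
  (forall c, \sum_k Y (e k).1 (e k).2 * dlog_row a b x k c = 0) <->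
  [/\ forall i, \sum_j Y i j = 0, forall j, \sum_i Y i j = 0,
      forall i, \sum_j Y i j / (x (inl i) - x (inr j)) = 0 &
      forall j, \sum_i Y i j / (x (inl i) - x (inr j)) = 0].
Proof.
move=> YF.
have red (G : 'I_m -> 'I_n -> K) :
    \sum_k Y (e k).1 (e k).2 * G (e k).1 (e k).2 = \sum_i \sum_j Y i j * G i j.
  rewrite -(@sum_edges K (fun i j => Y i j * G i j)) // => i j /YF ->.
  exact: mul0r.
have r1 i0 : \sum_k Y (e k).1 (e k).2 * dlog_row a b x k (inl (inl i0)) =
    \sum_j Y i0 j.
  rewrite (red (fun i j => (i == i0)%:R + 0)) (bigD1 i0) //= [X in _ + X]big1 ?addr0.
    by apply: eq_bigr => j _; rewrite eqxx ?addr0 mulr1.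
  by move=> i /negbTE ni; rewrite big1 // => j _; rewrite ni ?addr0 mulr0.
have r2 j0 : \sum_k Y (e k).1 (e k).2 * dlog_row a b x k (inl (inr j0)) =
    \sum_i Y i j0.
  rewrite (red (fun i j => 0 + (j == j0)%:R)); apply: eq_bigr => i _.
  rewrite (bigD1 j0) //= [X in _ + X]big1 ?addr0; first by rewrite eqxx add0r mulr1.
  by move=> j /negbTE nj; rewrite nj ?add0r mulr0.
have r3 i0 : \sum_k Y (e k).1 (e k).2 * dlog_row a b x k (inr (inl i0)) =
    \sum_j Y i0 j / (x (inl i0) - x (inr j)).
  rewrite (red (fun i j => ((i0 == i)%:R - 0) / (x (inl i) - x (inr j)))).
  rewrite (bigD1 i0) //= [X in _ + X]big1 ?addr0.
    by apply: eq_bigr => j _; rewrite eqxx subr0 mul1r.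
  move=> i /negbTE; rewrite eq_sym => ni; rewrite big1 // => j _.
  by rewrite ni subr0 mul0r mulr0.
have r4 j0 : \sum_k Y (e k).1 (e k).2 * dlog_row a b x k (inr (inr j0)) =
    - \sum_i Y i j0 / (x (inl i) - x (inr j0)).
  rewrite (red (fun i j => (0 - (j0 == j)%:R) / (x (inl i) - x (inr j)))).
  rewrite -sumrN; apply: eq_bigr => i _.
  rewrite (bigD1 j0) //= [X in _ + X]big1 ?addr0.
    by rewrite eqxx sub0r mulN1r mulrN.
  by move=> j /negbTE; rewrite eq_sym => ->; rewrite subr0 mul0r mulr0.
split=> [y0|[y1 y2 y3 y4] [[i|j]|[i|j]]]; last 4 first.
- by rewrite r1.
- by rewrite r2.
- by rewrite r3.
- by rewrite r4 y4 oppr0.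
split=> [i|j|i|j].
- by rewrite -r1.
- by rewrite -r2.
- by rewrite -r3.
- by apply: oppr_inj; rewrite -r4 y0 oppr0.
Qed.

(** Dividing a relation [Y] by the differences of the points gives [Z]. The four families of
    equations say that, after rescaling by [rho] and [gam], the columns of [Z] lie in the column
    space of [U] and its rows in that of [V]. So the rescaled matrix has the form [U *m D^T *m V^T];
    it vanishes off [F], and spanning makes it zero. *)
Lemma spans_dlog (K : fieldType) (f : nat -> K) s r (U : 'M[K]_(m, s))
    (V : 'M[K]_(n, r)) :
  injective f -> m = (s + 2)%N -> n = (r + 2)%N ->
  (forall h : 'I_s -> 'I_m, injective h -> \det (rowsub h U) != 0) ->
  (forall h : 'I_r -> 'I_n, injective h -> \det (rowsub h V) != 0) ->
  spans_at U V (~: F) ->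
  exists2 x : 'I_m + 'I_n -> K, injective x & indep_rows (dlog_row a b x).
Proof.
move=> f_inj ms nr detU detV spE.
have [rho [al [rho0 al_inj imU]]] := kernel_points f_inj ms detU.
have [gam [be [gam0 be_inj imV]]] := kernel_points f_inj nr detV.
have sm : (s <= m)%N by rewrite ms leq_addr.
have wi : injective (widen_ord sm) by move=> i j []/ord_inj.
have Uinj p (C : 'M[K]_(s, p)) := injective_mulmxr (C := C) (detU _ wi).
(* A translation of the second family of points separating it from the first. *)
have [w w0] : exists w, (\prod_i \prod_j ('X - (al i - be j)%:P)).[w] != 0.
  apply: infinite_nonroot f_inj _; apply/prodf_neq0 => i _.
  by apply/prodf_neq0 => j _; rewrite polyXsubC_eq0.
have wab i j : al i != be j + w.
  move: w0; rewrite horner_prod => /prodf_neq0/(_ i isT).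
  rewrite horner_prod => /prodf_neq0/(_ j isT); rewrite hornerXsubC.
  by apply: contra => /eqP->; rewrite [be j + w]addrC addrK subrr.
pose x (v : 'I_m + 'I_n) := match v with inl i => al i | inr j => be j + w end.
exists x.
  case=> [i|j] [i'|j'] /= e0; first by rewrite (al_inj _ _ e0).
  - by case/eqP: (wab i j').
  - by case/eqP: (wab i' j).
  by rewrite (be_inj _ _ (addIr w e0)).
move=> y y0; have [Y YF Ye] := extend_edges y.
have [y1 y2 y3 y4] : [/\ forall i, \sum_j Y i j = 0, forall j, \sum_i Y i j = 0,
      forall i, \sum_j Y i j / (x (inl i) - x (inr j)) = 0 &
      forall j, \sum_i Y i j / (x (inl i) - x (inr j)) = 0].
  by apply/(dlog_rowsP _ YF) => c; rewrite -[RHS](y0 c); apply: eq_bigr => k _; rewrite Ye.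
have xd i j : x (inl i) - x (inr j) != 0 by rewrite subr_eq0 wab.
pose Z i j := Y i j / (x (inl i) - x (inr j)).
have ZY i j : Y i j = Z i j * (al i - (be j + w)) by rewrite divfK ?xd.
have z1 j : \sum_i Z i j * al i = 0.
  transitivity (\sum_i Y i j + (\sum_i Z i j) * (be j + w)); last first.
    by rewrite y2 y4 mul0r addr0.
  rewrite mulr_suml -big_split /=; apply: eq_bigr => i _.
  by rewrite ZY mulrBr subrK.
have z2 i : \sum_j Z i j * be j = 0.
  transitivity ((\sum_j Z i j) * (al i - w) - \sum_j Y i j); last first.
    by rewrite y1 y3 mul0r subr0.
  rewrite mulr_suml -sumrB; apply: eq_bigr => j _.
  by rewrite ZY; ring.
pose X := \matrix_(i, j) (Z i j / rho i / gam j).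
have Xal i j : X i j * rho i = Z i j / gam j.
  by rewrite mxE mulrAC divfK.
have Xbe i j : X i j * gam j = Z i j / rho i.
  by rewrite mxE divfK.
have [C XC] : exists C, X = U *m C.
  apply: imU => j.
    under eq_bigr do rewrite Xal.
    by rewrite -mulr_suml y4 mul0r.
  under eq_bigr do rewrite Xal mulrAC.
  by rewrite -mulr_suml z1 mul0r.
have C1 (g : 'cV[K]_n) : (forall i, \sum_j X i j * g j 0 = 0) -> C *m g = 0.
  move=> Xg; apply: Uinj; rewrite mulmxA -XC; apply/matrixP => i j.
  by rewrite ord1 !mxE -[RHS](Xg i); apply: eq_bigr => k _.
have [D CD] : exists D, C^T = V *m D.
  apply: imV => k.
    have /colP/(_ k) : C *m (\col_j gam j) = 0.
      apply: C1 => i; under eq_bigr do rewrite [X in _ * X]mxE Xbe.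
      by rewrite -mulr_suml y3 mul0r.
    rewrite !mxE => C0; rewrite -[RHS]C0.
    by apply: eq_bigr => j _; rewrite !mxE.
  have /colP/(_ k) : C *m (\col_j (gam j * be j)) = 0.
    apply: C1 => i; under eq_bigr do rewrite [X in _ * X]mxE mulrA Xbe mulrAC.
    by rewrite -mulr_suml z2 mul0r.
  rewrite !mxE => C0; rewrite -[RHS]C0.
  by apply: eq_bigr => j _; rewrite !mxE mulrA.
have XD : X = U *m D^T *m V^T by rewrite XC -mulmxA -trmx_mul -CD trmxK.
have D0 : D^T = 0.
  apply: spE => i j; rewrite inE => nF.
  by rewrite -XD mxE /Z YF // !mul0r.
move=> k; rewrite -Ye ZY; suff -> : Z (e k).1 (e k).2 = 0 by rewrite mul0r.
have := Xbe (e k).1 (e k).2; rewrite XD D0 mulmx0 mul0mx mxE mul0r => /esym/eqP.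
by rewrite mulf_eq0 invr_eq0 (negbTE (rho0 _)) orbF => /eqP.
Qed.

(** The previous argument read backwards: a matrix [U *m C *m V^T] vanishing off [F], multiplied
    entrywise by the differences of the points, is a relation between the dlog rows. *)
Lemma dlog_spans (K : fieldType) s r (x : 'I_m + 'I_n -> K) :
  m = (s + 2)%N -> n = (r + 2)%N -> injective x -> indep_rows (dlog_row a b x) ->
  exists (U : 'M[K]_(m, s)) (V : 'M[K]_(n, r)), spans_at U V (~: F).
Proof.
move=> ms nr x_inj indx.
have [U [Uinj U1 U2]] := points_kernel (x \o inl) ms.
have [V [Vinj V1 V2]] := points_kernel (x \o inr) nr.
have xd i j : x (inl i) - x (inr j) != 0 by rewrite subr_eq0; apply/eqP => /x_inj.
exists U, V => C CE; pose X := U *m C *m V^T.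
suff X0 : X = 0.
  apply: Uinj; apply: trmx_inj; rewrite trmx0; apply: Vinj; apply: trmx_inj.
  by rewrite trmx_mul !trmxK trmx0.
have XF i j : (i, j) \notin F -> X i j = 0.
  by move=> nF; apply: CE; rewrite inE.
have colX (g : 'I_m -> K) j : (forall k, \sum_i U i k * g i = 0) ->
    \sum_i X i j * g i = 0.
  move=> Ug; have gU : (\row_i g i) *m U = 0.
    apply/rowP => k; rewrite !mxE -[RHS](Ug k).
    by apply: eq_bigr => i _; rewrite mxE mulrC.
  have /rowP/(_ j) : (\row_i g i) *m X = 0 by rewrite /X !mulmxA gU !mul0mx.
  rewrite !mxE => X0; rewrite -[RHS]X0.
  by apply: eq_bigr => i _; rewrite [X in _ = X * _]mxE mulrC.
have rowX (g : 'I_n -> K) i : (forall k, \sum_j V j k * g j = 0) ->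
    \sum_j X i j * g j = 0.
  move=> Vg; have gV : V^T *m (\col_j g j) = 0.
    apply/colP => k; rewrite !mxE -[RHS](Vg k).
    by apply: eq_bigr => j _; rewrite !mxE.
  have /colP/(_ i) : X *m (\col_j g j) = 0 by rewrite /X -mulmxA gV mulmx0.
  rewrite !mxE => X0; rewrite -[RHS]X0.
  by apply: eq_bigr => j _; rewrite [X in _ = _ * X]mxE.
have c1 j : \sum_i X i j = 0.
  rewrite -[RHS](colX (fun=> 1) j); first by apply: eq_bigr => i _; rewrite mulr1.
  by move=> k; rewrite -[RHS](U1 k); apply: eq_bigr => i _; rewrite mulr1.
have r1 i : \sum_j X i j = 0.
  rewrite -[RHS](rowX (fun=> 1) i); first by apply: eq_bigr => j _; rewrite mulr1.
  by move=> k; rewrite -[RHS](V1 k); apply: eq_bigr => j _; rewrite mulr1.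
have c2 j : \sum_i X i j * x (inl i) = 0 by apply: colX.
have r2 i : \sum_j X i j * x (inr j) = 0 by apply: rowX.
pose Y i j := X i j * (x (inl i) - x (inr j)).
have YF i j : (i, j) \notin F -> Y i j = 0 by move=> nF; rewrite /Y XF ?mul0r.
have YX i j : Y i j / (x (inl i) - x (inr j)) = X i j by rewrite mulfK.
have y0 : forall c, \sum_k Y (e k).1 (e k).2 * dlog_row a b x k c = 0.
  apply/(dlog_rowsP _ YF); split=> [i|j|i|j].
  - under eq_bigr do rewrite /Y mulrBr.
    by rewrite sumrB -mulr_suml r1 r2 mul0r subrr.
  - under eq_bigr do rewrite /Y mulrBr.
    by rewrite sumrB -mulr_suml c1 c2 mul0r subrr.
  - by under eq_bigr do rewrite YX.
  - by under eq_bigr do rewrite YX.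
have Y0 := indx _ y0; apply/matrixP => i j; rewrite [RHS]mxE -YX.
have [|nF] := boolP ((i, j) \in F); last by rewrite YF // mul0r.
by rewrite defF => /imsetP[k _ ek]; have := Y0 k; rewrite -ek /= => ->; rewrite mul0r.
Qed.

End TwoTwo.

Lemma spans_two_two_transfer (K0 K : fieldType) (f0 : nat -> K0) (f : nat -> K)
    m n s r (U0 : 'M[K0]_(m, s)) (V0 : 'M[K0]_(n, r)) (E : {set 'I_m * 'I_n}) :
  injective f0 -> injective f -> m = (s + 2)%N -> n = (r + 2)%N ->
  (forall h : 'I_s -> 'I_m, injective h -> \det (rowsub h U0) != 0) ->
  (forall h : 'I_r -> 'I_n, injective h -> \det (rowsub h V0) != 0) ->
  spans_at U0 V0 E ->
  exists (U : 'M[K]_(m, s)) (V : 'M[K]_(n, r)), spans_at U V E.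
Proof.
move=> f0_inj f_inj ms nr detU detV spE.
have [e e_inj defF] := enum_base (erefl #|~: E|).
rewrite -[E]setCK in spE *.
have [x x_inj indx] := spans_dlog e_inj defF f0_inj ms nr detU detV spE.
have m0 : (0 < m)%N by rewrite ms addn2.
pose left (v : 'I_m + 'I_n) := if v is inl _ then true else false.
have lab k : left (inl (e k).1) && ~~ left (inr (e k).2) by [].
have ab k : inl (e k).1 != inr (e k).2 :> 'I_m + 'I_n by [].
have [Q [uQ Q0 Qf indQ]] := dlog_ordered
  (left := left) ab
  (inl (Ordinal m0)) lab x_inj indx.
have [y y_inj indy] := ordered_dlog ab f_inj uQ Q0 Qf (@ordered_row_transfer K0 K _ _ _ _ _ indQ).
exact: (dlog_spans e_inj defF ms nr y_inj indy).
Qed.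

(** * Corank at most one *)

Lemma adapted_basis (K : fieldType) (vT : vectType K) (I : finType)
    (W : I -> {vspace vT}) : directv (\sum_i W i) ->
  exists2 X : (\dim {:vT}).-tuple vT, basis_of fullv X &
    forall i, (W i <= <<[seq x <- X | x \in W i]>>)%VS.
Proof.
move=> dW; pose S := (\sum_i W i)%VS.
pose X := \big[cat/[::]]_i (vbasis (W i) : seq vT) ++ vbasis (S^C)%VS.
have bX : basis_of fullv X.
  rewrite -(addv_complf S); apply: cat_basis; last exact: vbasisP.
    by apply/directv_addP; apply: capv_compl.
  by apply: bigcat_basis => // i _; apply: vbasisP.
have sX : size X == \dim {:vT} by rewrite (@vector.size_basis _ _ fullv _ (in_tuple X) bX).
exists (Tuple sX) => // i; rewrite -{1}(span_basis (vbasisP (W i))).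
apply: sub_span => x xW; rewrite mem_filter (vbasis_mem xW) /= mem_cat.
apply/orP; left; have : i \in index_enum I by rewrite mem_index_enum.
elim: (index_enum I) => // j r IHr; rewrite inE big_cons mem_cat.
by case/predU1P=> [<-|/IHr ->]; rewrite ?xW ?orbT.
Qed.

Lemma adapted_coord (K : fieldType) (vT : vectType K) (W : {vspace vT}) N
    (X : N.-tuple vT) d k :
  free X -> (W <= <<[seq x <- X | x \in W]>>)%VS -> d \in W ->
  X`_k \notin W -> forall kN : (k < N)%N, coord X (Ordinal kN) d = 0.
Proof.
move=> fX sW dW kW kN; apply/eqP.
have : (<<[seq x <- X | x \in W]>> <= lker (linfun (coord X (Ordinal kN) : vT -> K^o)))%VS.
  apply/span_subvP => x; rewrite mem_filter => /andP[xW /(nthP 0)[l lX xl]].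
  rewrite memv_ker lfunE /= -xl; rewrite size_tuple in lX.
  rewrite (coord_free (Ordinal lX) (Ordinal kN)) // -val_eqE /=.
  by have [lk|//] := eqVneq l k; rewrite -lk xl xW in kW.
by move/(subv_trans sW)/subvP/(_ d dW); rewrite memv_ker lfunE.
Qed.

Section Pattern.
Variables (K : fieldType) (m n r : nat) (V : 'M[K]_(n, r)).
Variable E : {set 'I_m * 'I_n}.

Definition annihilates i (d : 'rV[K]_r) :=
  forall j, (i, j) \in E -> \sum_k d 0 k * V j k = 0.

Lemma annihilator_space i : exists W : {vspace 'rV[K]_r},
  forall d, d \in W <-> annihilates i d.
Proof.
pose B := \matrix_(j, k) (if (i, j) \in E then V j k else 0).
exists (lker (linfun (mulmxr B^T : 'rV[K]_r -> 'rV[K]_n))) => d.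
rewrite memv_ker lfunE /=; split=> [/eqP/rowP dB j ijE | dV].
  have := dB j; rewrite !mxE => dj; rewrite -[RHS]dj.
  by apply: eq_bigr => k _; rewrite !mxE ijE.
apply/eqP/rowP => j; rewrite !mxE; have [ijE|nE] := boolP ((i, j) \in E).
  rewrite -[RHS](dV j ijE); apply: eq_bigr => k _.
  by rewrite !mxE ijE.
by rewrite big1 // => k _; rewrite !mxE (negbTE nE) mulr0.
Qed.

(** In a basis [g] adapted to the annihilators, [Z] is the set of nonzero entries of [V] and [B i]
    collects the basis vectors lying in the i-th annihilator. No nonzero combination of the others
    is killed by the [v_j] with [(i, j)] in [E], so these [v_j] have a nonzero minor on the columns
    outside [B i]. *)
Lemma independent_annihilators_pattern :
  (forall d : 'I_m -> 'rV[K]_r, (forall i, annihilates i (d i)) ->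
     \sum_i d i = 0 -> forall i, d i = 0) ->
  exists (Z : 'I_n -> 'I_r -> bool) (B : 'I_m -> {set 'I_r}),
    [/\ forall i i' k, k \in B i -> k \in B i' -> i = i',
        forall i, (forall d, annihilates i d -> d = 0) -> B i = set0,
        forall i j k, (i, j) \in E -> k \in B i -> ~~ Z j k &
        forall i, exists2 h : 'I_#|~: B i| -> 'I_n, injective h &
          forall a, (i, h a) \in E /\ Z (h a) (enum_val a)].
Proof.
move=> indW; have [W WP] : exists W : 'I_m -> {vspace 'rV[K]_r},
    forall i d, d \in W i <-> annihilates i d.
  exact: (fin_all_exists annihilator_space).
have dW : directv (\sum_i W i).
  apply/directv_sum_independent => d dW d0 i _.
  by apply: indW d0 i => i; apply/WP/dW.
have [X bX WX] := adapted_basis dW.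
have dimr : \dim {:'rV[K]_r} = r by rewrite dimvf dim_matrix; apply: mul1n.
have fX := basis_free bX.
pose g (k : 'I_r) := X`_k.
have kX (k : 'I_r) : (k < \dim {:'rV[K]_r})%N by rewrite dimr.
have g0 k : g k != 0.
  apply/eqP => gk; have : g k \in (X : seq _) by rewrite mem_nth // size_tuple.
  by rewrite gk => X0; move/free_not0: fX => /(_ _ X0) /negP[].
pose T j k := \sum_l (g k) 0 l * V j l.
exists (fun j k => T j k != 0), (fun i => [set k | g k \in W i]); split.
- move=> i i' k; rewrite !inE => kW kW'; apply/eqP; apply: contraT => ni.
  pose d l : 'rV[K]_r := if l == i then g k else if l == i' then - g k else 0.
  have := indW d _ _ i; rewrite {3}/d eqxx => d0.
  have : g k = 0; last by move/eqP; rewrite (negbTE (g0 k)).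
  apply: d0 => [l|].
    apply/WP; rewrite /d; case: eqP => [->//|_].
    by case: eqP => [->|_]; rewrite ?memvN ?mem0v.
  rewrite (bigD1 i) //= (bigD1 i') 1?eq_sym //= big1 ?addr0 /d.
    by rewrite eqxx eq_sym (negbTE ni) eqxx subrr.
  by move=> l /andP[/negbTE-> /negbTE->].
- move=> i W0; apply/setP => k; rewrite !inE; apply/negP => /WP/W0 gk.
  by move: (g0 k); rewrite gk eqxx.
- by move=> i j k ijE; rewrite inE negbK => /WP/(_ j ijE)/eqP.
move=> i; set B := [set k | _].
pose F (a : 'I_#|~: B|) j := if (i, j) \in E then T j (enum_val a) else 0.
have indF : indep_rows F.
  move=> y y0.
  pose c k := \sum_(a | enum_val a == k) y a.
  pose d := \sum_a y a *: g (enum_val a).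
  have dWi : d \in W i.
    apply/WP => j ijE; rewrite -[RHS](y0 j) /F ijE.
    under eq_bigr do rewrite /d summxE mulr_suml.
    rewrite exchange_big /=; apply: eq_bigr => a _.
    by rewrite mulr_sumr; apply: eq_bigr => l _; rewrite !mxE mulrA.
  move=> a; have aB : g (enum_val a) \notin W i.
    by have := enum_valP a; rewrite !inE.
  rewrite -(adapted_coord fX (WX i) dWi aB (kX _)) /d linear_sum (bigD1 a) //=.
  rewrite linearZ /= (coord_free (Ordinal (kX (enum_val a)))) // eqxx mulr1.
  rewrite big1 ?addr0 // => b ba; rewrite linearZ /=.
  rewrite (coord_free (Ordinal (kX (enum_val b)))) // -val_eqE /=.
  by rewrite val_eqE (inj_eq enum_val_inj) (negbTE ba) mulr0.
have [h dh] := (indep_rows_det F).1 indF.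
(* A nonzero term of the Leibniz expansion; only its positions matter for the pattern. *)
have [s hs] : exists s : {perm 'I_#|~: B|}, \prod_a F a (h (s a)) != 0.
  apply/existsP; apply: contraNT dh; rewrite negb_exists => /forallP F0.
  apply/eqP; rewrite /determinant big1 // => s _; apply/eqP.
  rewrite mulf_eq0; apply/orP; right; have := F0 s; rewrite negbK.
  by under [X in _ -> X == 0]eq_bigr do rewrite mxE.
have Fs a : F a (h (s a)) != 0 by move/prodf_neq0/(_ a isT): hs.
exists (fun a => h (s a)) => [a b hab|a]; last first.
  by have := Fs a; rewrite /F; case: ifP => //; rewrite eqxx.
apply/(@perm_inj _ s)/eqP; apply: contraT => nab; case/negP: dh.
rewrite -det_tr; apply/eqP; apply: (determinant_alternate nab) => c.
by rewrite !mxE hab.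
Qed.

End Pattern.

(** In the rows selected by [h] the masked matrix vanishes on [B], so the equations on [d] form a
    square system in the remaining coordinates, with nonzero determinant by genericity. *)
Lemma mask_annihilator (K : fieldType) m n s r (U : 'M[K]_(m, s))
    (V : 'M[K]_(n, r)) (E : {set 'I_m * 'I_n}) (Z : 'I_n -> 'I_r -> bool) i
    (B : {set 'I_r}) (h : 'I_#|~: B| -> 'I_n) d k :
  generic_vectors U V -> (forall j l, (i, j) \in E -> l \in B -> ~~ Z j l) ->
  injective h -> (forall a, (i, h a) \in E /\ Z (h a) (enum_val a)) ->
  annihilates (mask Z V) E i d -> k \notin B -> d 0 k = 0.
Proof.
move=> gUV ZB h_inj hZ dV kB.
have dM := generic_det_mask gUV h_inj (@enum_val_inj _ _) (fun a => (hZ a).2).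
have kB' : k \in ~: B by rewrite inE.
have /colP/(_ (enum_rank_in kB' k)) : \col_a d 0 (enum_val a) = 0 :> 'cV[K]_#|~: B|.
  apply: (det_mulmxr_inj _).1 dM _ _; apply/colP => a; rewrite !mxE.
  rewrite -[RHS](dV (h a) (hZ a).1) (bigID [pred l | l \in ~: B]) /=.
  rewrite [X in _ + X]big1 ?addr0 => [|l]; last first.
    by rewrite inE negbK mxE => /(ZB _ _ (hZ a).1)/negbTE->; rewrite mulr0.
  rewrite [RHS]big_enum_val; apply: eq_bigr => b _.
  by rewrite !mxE mulrC.
by rewrite !mxE enum_rankK_in.
Qed.

Lemma spans_corank_le1_transfer (K0 K : fieldType) m s n r a
    (U0 : 'M[K0]_(m, s)) (V0 : 'M[K0]_(n, r))
    (U : 'M[K]_(m, s)) (V : 'M[K]_(n, r)) (E : {set 'I_m * 'I_n}) :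
  m = (s + a)%N -> (a <= 1)%N -> \rank U0 = s -> generic_vectors U V ->
  spans_at U0 V0 E ->
  exists (U' : 'M[K]_(m, s)) (V' : 'M[K]_(n, r)), spans_at U' V' E.
Proof.
move=> ms a1 rU0 gUV spE.
have [N [Nfree NU0] kerN] := column_space_equations ms rU0.
have lift (D : 'M_(m, r)) : N *m D = 0 ->
    (forall i, annihilates V0 E i (row i D)) -> D = 0.
  move=> /kerN[C DC] Dann; rewrite DC (spE C) ?mulmx0 // => i j ijE.
  rewrite -DC mxE -[RHS](Dann i j ijE).
  by apply: eq_bigr => k _; rewrite !mxE.
(* When column [i] of [N] is zero, the matrix with [d] as its only nonzero row satisfies the
   equations of the column space. *)
have single i d : (forall c, N c i = 0) -> annihilates V0 E i d -> d = 0.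
  move=> Ni dann; pose D := \matrix_(l, k) ((l == i)%:R * d 0 k).
  have Drow l : row l D = (l == i)%:R *: d by apply/rowP => k; rewrite !mxE.
  have D0 : D = 0.
    apply: lift => [|l j ljE]; last first.
      rewrite Drow; case: eqP ljE => [->|_] ijE.
        by rewrite scale1r; apply: dann.
      by rewrite scale0r big1 // => k _; rewrite mxE mul0r.
    apply/matrixP => c k; rewrite !mxE big1 // => l _; rewrite !mxE.
    by case: eqP => [->|_]; rewrite ?Ni ?mul0r ?mulr0.
  by have := Drow i; rewrite D0 eqxx scale1r => <-; apply/rowP => k; rewrite !mxE.
have indW (d : 'I_m -> 'rV[K0]_r) : (forall i, annihilates V0 E i (d i)) ->
    \sum_i d i = 0 -> forall i, d i = 0.
  move=> dann d0; case: a a1 ms N Nfree NU0 kerN lift single => [|[|//]] _ ms N _ _ _ lift single i.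
    by apply: single (dann i) => -[].
  (* If [N 0 l = 0] the inverse is 0 by convention, which does no harm since [single] gives
     [d l = 0]. *)
  pose D := \matrix_(l, k) ((N 0 l)^-1 * d l 0 k).
  have ND l k : N 0 l * D l k = d l 0 k.
    rewrite mxE mulrA; have [Nl|Nl] := eqVneq (N 0 l) 0; last by rewrite divff ?mul1r.
    by rewrite (single l (d l)) ?mxE ?mulr0 // => c; rewrite ord1.
  have D0 : D = 0.
    apply: lift => [|l j ljE].
      apply/matrixP => c k; rewrite !mxE ord1; move/rowP/(_ k): d0.
      rewrite summxE mxE => d0; rewrite -[RHS]d0.
      by apply: eq_bigr => l _; apply: ND.
    rewrite -[RHS](mulr0 (N 0 l)^-1) -[in RHS](dann l j ljE) mulr_sumr.
    by apply: eq_bigr => k _; rewrite !mxE mulrA.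
  by apply/rowP => k; rewrite -ND D0 !mxE mulr0.
have [Z [B [B_inj B0 ZB ZE]]] := independent_annihilators_pattern indW.
(* Over [K] the equation of the column space is taken to have all coefficients 1; for [a = 0] there
   is no equation. *)
have [A Afree A1] : exists2 A : 'M[K]_(s, m), row_free A & A *m (const_mx 1 : 'M_(m, a)) = 0.
  by apply: left_kernel_basis; rewrite [leqRHS]ms addnC leq_add2l rank_leq_col.
exists A^T, (mask Z V) => C CE.
have DB i k : k \notin B i -> (A^T *m C) i k = 0.
  move=> kB; have [h h_inj hZ] := ZE i.
  have := mask_annihilator (d := row i (A^T *m C)) gUV (ZB i) h_inj hZ _ kB.
  rewrite mxE; apply => j ijE; rewrite -[RHS](CE i j ijE) [RHS]mxE.
  by apply: eq_bigr => l _; rewrite [row _ _ _ _]mxE [_^T l j]mxE.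
suff AC : A^T *m C = 0.
  apply/trmx_inj/(row_free_inj Afree).
  by rewrite /= -[A]trmxK -trmx_mul AC !trmx0 mul0mx.
apply/matrixP => i k; rewrite [RHS]mxE.
have [kB|/DB//] := boolP (k \in B i).
case: a a1 ms N Nfree NU0 kerN lift single A1 => [|[|//]] _ ms N _ _ _ lift single A1.
  by rewrite B0 ?inE // in kB => d; apply: single => -[].
(* The sets [B l] are disjoint, so [i] is the only row that can contribute to coordinate [k]. *)
have : \sum_l (A^T *m C) l k = 0.
  have /rowP/(_ k) : (const_mx 1 : 'M_(m, 1))^T *m (A^T *m C) = 0.
    by rewrite mulmxA -trmx_mul A1 trmx0 mul0mx.
  rewrite !mxE => S0; rewrite -[RHS]S0.
  by apply: eq_bigr => l _; rewrite !mxE mul1r.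
rewrite (bigD1 i) //= big1 ?addr0 // => l li; apply: DB.
by apply: contra li => kl; apply/eqP/(B_inj _ _ k).
Qed.

(** * Columns with few large fibres *)

Lemma subset_of_card (T : finType) (S1 S2 : {set T}) k :
  S1 \subset S2 -> (#|S1| <= k <= #|S2|)%N ->
  exists S : {set T}, [/\ S1 \subset S, S \subset S2 & #|S| = k].
Proof.
move=> sS /andP[le1 le2]; have [d] := ubnP (k - #|S1|)%N.
elim: d S1 sS le1 => // d IHd S1 sS le1 ltd.
have [eqk|nk] := eqVneq #|S1| k; first by exists S1.
have lt1 : (#|S1| < k)%N by rewrite ltn_neqAle nk.
have /set0Pn[x] : S2 :\: S1 != set0.
  by rewrite -card_gt0 cardsD (setIidPr sS) subn_gt0 (leq_trans lt1).
rewrite inE => /andP[x1 x2].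
have cx : #|x |: S1| = #|S1|.+1 by rewrite cardsU1 x1.
have [|||S [s1 s2 cS]] := IHd (x |: S1); rewrite ?cx //.
- by rewrite subUset sub1set x2.
- by rewrite -ltnS (leq_trans _ ltd) // ltnS ltn_sub2l.
by exists S; split=> //; apply: subset_trans s1; apply: subsetUr.
Qed.

Section Choice.
Variables (K : fieldType) (vT : vectType K) (I : finType).

Lemma eq_linear_indep (f g : I -> vT) (E : {set I}) : {in E, f =1 g} ->
  (E \in linear_indep f) = (E \in linear_indep g).
Proof.
move=> fg; rewrite !inE /image_mem; congr free; apply/eq_in_map => x.
by rewrite mem_enum => /fg.
Qed.

Lemma linear_indepD1 (f : I -> vT) (E : {set I}) x : x \in E ->
  (E \in linear_indep f) =
  (f x \notin <<[seq f y | y in E :\ x]>>%VS) && (E :\ x \in linear_indep f).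
Proof.
move=> xE; rewrite !inE /image_mem -free_cons -map_cons; apply: perm_free.
apply: perm_map; apply: uniq_perm => [||y].
- exact: enum_uniq.
- by rewrite /= mem_enum !inE eqxx enum_uniq.
- by rewrite !(inE, mem_enum); case: eqP => // ->.
Qed.

(** The vectors are replaced one at a time. If a sum lies outside the span of the other vectors, so
    does one of its summands with nonzero coefficient. *)
Lemma linear_indep_choice (R : finType) (E : {set I}) (v : I -> R -> K)
    (w : I -> R -> vT) (g0 : I -> R) :
  E \in linear_indep (fun x => \sum_t v x t *: w x t) ->
  exists2 g : I -> R, E \in linear_indep (fun x => w x (g x)) &
    forall x, x \in E -> v x (g x) != 0.
Proof.
move=> indE; pose S x := \sum_t v x t *: w x t.
have main (s : seq I) : {subset s <= E} -> exists2 g : I -> R,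
    E \in linear_indep (fun x => if x \in s then w x (g x) else S x) &
    forall x, x \in s -> v x (g x) != 0.
  elim: s => [|x s IHs] sE; first by exists g0.
  have [|g indg vg] := IHs; first by move=> y ys; apply: sE; rewrite inE ys orbT.
  have [xs|xs] := boolP (x \in s).
    exists g => [|y]; last by rewrite inE => /predU1P[->|]; apply: vg.
    rewrite (eq_linear_indep (g := fun x => if x \in s then w x (g x) else S x)) //.
    by move=> y _; rewrite inE; case: eqP => [->|//]; rewrite xs.
  have xE : x \in E by apply: sE; rewrite inE eqxx.
  move: indg; rewrite (linear_indepD1 _ xE) (negbTE xs) => /andP[Sx indx].
  set W := <<_>>%VS in Sx.
  have [t vt wt] : exists2 t, v x t != 0 & w x t \notin W.
    apply/exists_inP; apply: contraNT Sx; rewrite negb_exists_in => /forall_inP wW.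
    apply: memv_suml => t _; have [->|vt] := eqVneq (v x t) 0.
      by rewrite scale0r mem0v.
    by apply: memvZ; have := wW t vt; rewrite negbK.
  pose g' := [eta g with x |-> t]; exists g'.
    have eqf : {in E :\ x, (fun y => if y \in x :: s then w y (g' y) else S y) =1
                           (fun y => if y \in s then w y (g y) else S y)}.
      by move=> y; rewrite !inE /= => /andP[/negbTE-> _].
    rewrite (linear_indepD1 _ xE) (eq_linear_indep eqf) indx andbT inE eqxx /=.
    rewrite eqxx; suff -> : [seq (if y \in x :: s then w y (g' y) else S y) | y in E :\ x]
        = [seq (if y \in s then w y (g y) else S y) | y in E :\ x] by [].
    by apply/eq_in_map => y; rewrite mem_enum => /eqf.
  move=> y; rewrite inE /=; have [->//|_] := eqVneq y x; exact: vg.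
have [|g indg vg] := main (enum E); first by move=> x; rewrite mem_enum.
exists g => [|x xE]; last by apply: vg; rewrite mem_enum.
rewrite (eq_linear_indep (g := fun x => if x \in enum E then w x (g x) else S x)) //.
by move=> x xE; rewrite mem_enum xE.
Qed.

End Choice.

Section Uniform.
Variables (K : fieldType) (m s : nat) (U : 'M[K]_(m, s)).
Hypothesis detU : forall h : 'I_s -> 'I_m, injective h -> \det (rowsub h U) != 0.
Hypothesis sm : (s <= m)%N.

Lemma uniform_rows_indep (S : {set 'I_m}) (y : 'I_m -> K) :
  (#|S| <= s)%N -> (forall i, i \notin S -> y i = 0) ->
  (forall a, \sum_i y i * U i a = 0) -> forall i, y i = 0.
Proof.
move=> cS yS yU; have [|S' [sS _ cS']] := subset_of_card (subsetT S) (k := s).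
  by rewrite cS cardsT card_ord.
have [h h_inj hS] := enum_base cS'.
have /det_mulmxl_inj inj := detU h_inj.
have h0 : \row_k y (h k) = 0.
  apply: inj; apply/rowP => a; rewrite !mxE -[RHS](yU a).
  rewrite [RHS](bigID [pred i | i \in S']) /= [X in _ + X]big1 ?addr0; last first.
    by move=> i iS; rewrite yS ?mul0r //; apply: contra iS; apply: (subsetP sS).
  rewrite hS big_imset /=; last by move=> ? ? _ _; apply: h_inj.
  by apply: eq_bigr => k _; rewrite !mxE.
move=> i; have [iS|/yS//] := boolP (i \in S).
have : i \in S' by apply: (subsetP sS).
by rewrite hS => /imsetP[k _ ->]; move/rowP/(_ k): h0; rewrite !mxE.
Qed.

Lemma uniform_rows_span (S : {set 'I_m}) (c : 'I_s -> K) :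
  (s <= #|S|)%N -> (forall i, i \in S -> \sum_a U i a * c a = 0) ->
  forall a, c a = 0.
Proof.
move=> cS Sc; have [|S' [_ sS cS']] := subset_of_card (sub0set S) (k := s).
  by rewrite cards0.
have [h h_inj hS] := enum_base cS'.
have /det_mulmxr_inj inj := detU h_inj.
have /colP c0 : \col_a c a = 0.
  apply: inj; apply/colP => k; rewrite !mxE.
  have hk : h k \in S by apply: (subsetP sS); rewrite hS imset_f.
  by rewrite -[RHS](Sc _ hk); apply: eq_bigr => a _; rewrite !mxE.
by move=> a; have := c0 a; rewrite !mxE.
Qed.

End Uniform.

Lemma spans_at_mulmxr (K : fieldType) m s n r (U : 'M[K]_(m, s))
    (V : 'M[K]_(n, r)) G E :
  G \in unitmx -> spans_at U V E -> spans_at U (V *m G) E.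
Proof.
move=> uG spE C CE; suff CG : C *m G^T = 0.
  have uGT : G^T \in unitmx by rewrite unitmx_tr.
  by rewrite -[C](mulmxK uGT) CG mul0mx.
by apply: spE => i j ijE; rewrite -(CE i j ijE) trmx_mul !mulmxA.
Qed.

Lemma normalized_rows (K : fieldType) m n s r (U : 'M[K]_(m, s)) (V : 'M[K]_(n, r))
    (E : {set 'I_m * 'I_n}) (h : 'I_r -> 'I_n) :
  \det (rowsub h V) != 0 -> spans_at U V E ->
  exists2 V1 : 'M[K]_(n, r), forall k l, V1 (h k) l = (k == l)%:R & spans_at U V1 E.
Proof.
move=> dV spE; have uG : rowsub h V \in unitmx by rewrite unitmxE unitfE.
exists (V *m invmx (rowsub h V)); last first.
  by apply: spans_at_mulmxr; rewrite ?unitmx_inv.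
move=> k l; move/matrixP/(_ k l): (mulmxV uG).
by rewrite mul_rowsub_mx [LHS]mxE [RHS]mxE.
Qed.

Definition select (K : fieldType) n r (f : 'I_n -> 'I_r) : 'M[K]_(n, r) :=
  \matrix_(j, k) (k == f j)%:R.

(** The tensor space splits into [r] copies of K^s. Independence forces the elements of [E] falling
    in one copy to lie in distinct rows, at most [s] of them, and for [U] with nonzero maximal
    minors these conditions suffice. *)
Lemma select_transfer (K0 K : fieldType) m s n r (U0 : 'M[K0]_(m, s))
    (U : 'M[K]_(m, s)) (f : 'I_n -> 'I_r) (E : {set 'I_m * 'I_n}) :
  (s <= m)%N ->
  (forall h : 'I_s -> 'I_m, injective h -> \det (rowsub h U) != 0) ->
  indep_at U0 (select K0 f) E -> indep_at U (select K f) E.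
Proof.
move=> sm detU indE.
have selE (F : fieldType) (U1 : 'M[F]_(m, s)) X a k :
    (U1^T *m X *m select F f) a k = \sum_i (\sum_(j | f j == k) X i j) * U1 i a.
  rewrite mulmx3E; apply: eq_bigr => i _; rewrite mulr_suml [RHS]big_mkcond /=.
  apply: eq_bigr => j _; rewrite !mxE eq_sym mulrC.
  by case: eqP => _; rewrite ?mul1r ?mul0r // mulrC.
have uniqE i j j' : (i, j) \in E -> (i, j') \in E -> f j = f j' -> j = j'.
  move=> ijE ijE' fj; apply/eqP; apply: contraT => nj.
  (* The two elements carry the same tensor, and their difference is a relation. *)
  pose X : 'M[K0]_(m, n) := \matrix_(i1, j1) if i1 == i then (j1 == j)%:R - (j1 == j')%:R else 0.
  have : X = 0.
    apply: indE => [i1 j1 nE|].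
      rewrite mxE; case: eqP => // i1E; rewrite i1E in nE.
      have [j1E|_] := eqVneq j1 j; first by rewrite -j1E (negbTE nE) in ijE.
      have [j1E|_] := eqVneq j1 j'; first by rewrite -j1E (negbTE nE) in ijE'.
      exact: subrr.
    apply/matrixP => a k; rewrite selE mxE big1 // => i1 _.
    rewrite [X in X * _](_ : _ = 0) ?mul0r //.
    under eq_bigr do rewrite mxE; case: (i1 == i); last by rewrite big1.
    have sel u : \sum_(j1 | f j1 == k) (j1 == u)%:R = (f u == k)%:R :> K0.
      rewrite big_mkcond (bigD1 u) //= eqxx big1 ?addr0; first by case: (_ == k).
      by move=> j1 /negbTE->; case: ifP.
    by rewrite sumrB !sel fj subrr.
  move/matrixP/(_ i j); rewrite !mxE !eqxx (negbTE nj) subr0 => /eqP.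
  by rewrite oner_eq0.
pose S k := [set i | [exists j, ((i, j) \in E) && (f j == k)]].
have cardS k : (#|S k| <= s)%N.
  rewrite leqNgt; apply/negP => cS.
  (* More than [s] rows of [U0] are dependent; placing the coefficients at elements of [E] in copy
     [k] turns this into a relation [X]. *)
  pose A := \matrix_(a < #|S k|) row (enum_val a) U0.
  have : kermx A != 0.
    by rewrite kermx_eq0 /row_free neq_ltn (leq_ltn_trans (rank_leq_col _) cS).
  rewrite -nz_row_eq0; set v := nz_row _; case/negP; apply/eqP.
  have vA : v *m A = 0 by apply/sub_kermxP; apply: nz_row_sub.
  have [jj jjP] : exists jj : 'I_#|S k| -> 'I_n, forall a, (enum_val a, jj a) \in E /\ f (jj a) = k.
    apply: (fin_all_exists (P := fun a j => (enum_val a, j) \in E /\ f j = k)) => a.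
    by have := enum_valP a; rewrite inE => /existsP[j /andP[ajE /eqP]]; exists j.
  pose X : 'M[K0]_(m, n) := \sum_a v 0 a *: delta_mx (enum_val a) (jj a).
  have Xe a : X (enum_val a) (jj a) = v 0 a.
    rewrite /X summxE (bigD1 a) //= big1 => [|b ba]; rewrite !mxE.
      by rewrite !eqxx mulr1 addr0.
    by rewrite (inj_eq enum_val_inj) eq_sym (negbTE ba) mulr0.
  have X0 : X = 0.
    apply: indE => [i j nE|].
      rewrite /X summxE big1 // => a _; rewrite !mxE.
      case: eqP => [ia|_]; last by rewrite mulr0.
      case: eqP => [ja|_]; last by rewrite mulr0.
      by rewrite ia ja (jjP a).1 in nE.
    rewrite /X mulmx_sumr mulmx_suml; apply/matrixP => a k'; rewrite summxE mxE.
    transitivity ((k == k')%:R * (v *m A) 0 a); last by rewrite vA mxE mulr0.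
    rewrite [X in _ * X]mxE mulr_sumr; apply: eq_bigr => b _.
    rewrite -scalemxAr -scalemxAl mxE selE (bigD1 (enum_val b)) //= [X in _ + X]big1 ?addr0.
      rewrite !mxE big_mkcond (bigD1 (jj b)) //= [X in _ + X]big1 ?addr0.
        rewrite mxE !eqxx (jjP b).2; case: (k == k'); rewrite ?mul1r ?mul0r //.
        exact: mulr0.
      by move=> j /negbTE nj; rewrite mxE nj andbF; case: ifP.
    move=> i /negbTE ni; rewrite big1 ?mul0r // => j _.
    by rewrite mxE ni.
  by apply/rowP => a; rewrite -Xe X0 !mxE.
move=> X XE X0; apply/matrixP => i j; rewrite [RHS]mxE.
have [ijE|/XE//] := boolP ((i, j) \in E).
have := uniform_rows_indep detU sm (cardS (f j))
  (y := fun i => \sum_(j' | f j' == f j) X i j') _ _ i.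
rewrite (bigD1 j) //= big1 ?addr0 => [|j' /andP[/eqP fj nj]]; last first.
  by apply: XE; apply: contra nj => ijE'; apply/eqP; apply: uniqE ijE' ijE fj.
apply=> [i'|a]; last by rewrite -selE X0 mxE.
rewrite inE negb_exists => /forallP nS; rewrite big1 // => j' fj.
by apply: XE; have := nS j'; rewrite fj andbT.
Qed.

(** All columns with at least two elements can be among the [r] normalised ones. Every other column
    has at most one element, so choosing a basis vector for each element amounts to choosing one for
    each [v_j]. *)
Lemma spans_few_large_columns_transfer (K0 K : fieldType) m s n r
    (U0 : 'M[K0]_(m, s)) (V0 : 'M[K0]_(n, r)) (U : 'M[K]_(m, s))
    (E : {set 'I_m * 'I_n}) :
  (s <= m)%N -> (0 < r <= n)%N -> #|E| = (s * r)%N ->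
  (forall h : 'I_s -> 'I_m, injective h -> \det (rowsub h U) != 0) ->
  (forall h : 'I_r -> 'I_n, injective h -> \det (rowsub h V0) != 0) ->
  (#|[set j | 1 < #|[set i | (i, j) \in E]|]| <= r)%N ->
  spans_at U0 V0 E -> exists V : 'M[K]_(n, r), spans_at U V E.
Proof.
move=> sm /andP[r0 rn] cE detU detV cJ spE.
set J := [set j | _] in cJ.
have [|B [sJB _ cB]] := subset_of_card (subsetT J) (k := r).
  by rewrite cJ cardsT card_ord.
have [kap kap_inj defB] := enum_base cB.
have [V1 V1kap /(spans_indep _ _ cE) ind1] := normalized_rows (detV _ kap_inj) spE.
pose w (x : 'I_m * 'I_n) (k : 'I_r) : 'rV[K0]_(s * r) :=
  row x.1 U0 *t (delta_mx 0 k : 'rV[K0]_r).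
have wE x : row x.1 U0 *t row x.2 V1 = \sum_k V1 x.2 k *: w x k :> 'rV_(s * r).
  apply/rowP => c.
  have [a [b tE]] : exists a b, forall (u : 'rV[K0]_s) (v : 'rV[K0]_r),
      (u *t v : 'rV_(s * r)) 0 c = u 0 a * v 0 b.
    case: (mxtens_indexP c) => a b; exists a, b => u v; exact: tens_rowE.
  have wc k : w x k 0 c = U0 x.1 a * (k == b)%:R.
    by apply: (etrans (tE _ _)); rewrite !mxE eqxx eq_sym.
  apply: (etrans (tE _ _)); rewrite !mxE summxE (bigD1 b) //= [X in _ + X]big1 ?addr0.
    by rewrite mxE wc eqxx mulr1 mulrC.
  by move=> k /negbTE kb; rewrite mxE wc kb !mulr0.
have [g indg vg] : exists2 g : 'I_m * 'I_n -> 'I_r,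
    E \in linear_indep (fun x => w x (g x)) & forall x, x \in E -> V1 x.2 (g x) != 0.
  apply: (linear_indep_choice (v := fun x => V1 x.2)).
    by move=> _; apply: (Ordinal r0).
  rewrite -(eq_linear_indep (f := fun x => row x.1 U0 *t row x.2 V1)).
    exact/tensor_matroidP.
  by move=> x _; apply: wE.
(* On normalised columns the choice is forced by [V1kap]; an empty column gets an arbitrary
   value. *)
pose f j := if [pick k | kap k == j] is Some k then k else
  if [pick i | (i, j) \in E] is Some i then g (i, j) else Ordinal r0.
have fg i j : (i, j) \in E -> g (i, j) = f j.
  move=> ijE; rewrite /f; case: pickP => [k /eqP kj|nk].
    subst j; have := vg _ ijE; rewrite V1kap.
    by have [//|_] := eqVneq k (g (i, kap k)); rewrite eqxx.
  case: pickP => [i' ijE'|/(_ i)]; last by rewrite ijE.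
  suff -> : i' = i by [].
  have jJ : j \notin J.
    apply/negP => /(subsetP sJB); rewrite defB => /imsetP[k _ jk].
    by have := nk k; rewrite jk eqxx.
  move: jJ; rewrite inE -leqNgt => /card_le1_eqP; apply; by rewrite inE.
exists (select K f); apply/(spans_indep _ _ cE)/(select_transfer sm detU (U0 := U0)).
apply/tensor_matroidP; rewrite (eq_linear_indep (g := fun x => w x (g x))) //.
move=> [i j] ijE; rewrite fg // /w (_ : row _ (select _ _) = delta_mx 0 (f j)) //.
by apply/rowP => k; rewrite !mxE eqxx.
Qed.

(** * Three lines in the plane *)

Lemma sum_ord3 (R : nmodType) (F : 'I_3 -> R) :
  \sum_a F a = F (inord 0) + F (inord 1) + F (inord 2).
Proof.
rewrite !big_ord_recr big_ord0 /= add0r.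
by congr (F _ + F _ + F _); apply: val_inj; rewrite /= inordK.
Qed.

(** The determinant of rows [i], [j], [k], expanded so that [ring] can prove the identities
    below. *)
Definition triple (R : comPzRingType) m (U : 'M[R]_(m, 3)) i j k : R :=
  let x a := U i (inord a) in let y a := U j (inord a) in
  let z a := U k (inord a) in
  x 0%N * (y 1%N * z 2%N - y 2%N * z 1%N)
  - x 1%N * (y 0%N * z 2%N - y 2%N * z 0%N)
  + x 2%N * (y 0%N * z 1%N - y 1%N * z 0%N).

(* The determinant of e, f and the intersection [abc] d - [abd] c of the lines ab
   and cd. *)
Definition concurrency (R : comPzRingType) m (U : 'M[R]_(m, 3)) a b c d e f : R :=
  triple U a b c * triple U d e f - triple U a b d * triple U c e f.

Lemma map_concurrency (R S : comPzRingType) (h : {rmorphism R -> S}) m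
    (U : 'M[R]_(m, 3)) a b c d e f :
  h (concurrency U a b c d e f) = concurrency (map_mx h U) a b c d e f.
Proof.
have map_triple i j k : h (triple U i j k) = triple (map_mx h U) i j k.
  by rewrite /triple !(rmorphD, rmorphN, rmorphM) !mxE.
by rewrite /concurrency rmorphB !rmorphM !map_triple.
Qed.

Lemma generic_concurrency (K : fieldType) m n r (U : 'M[K]_(m, 3))
    (V : 'M[K]_(n, r)) a b c d e f :
  generic_vectors U V -> uniq [:: a; b; c; d; e; f] ->
  concurrency U a b c d e f != 0.
Proof.
move=> gUV u6; pose P := concurrency (varU m 3 n r) a b c d e f.
have evP U' V' : coord_eval U' V' P = concurrency U' a b c d e f :> K.
  by rewrite /P map_concurrency coord_eval_varU.
rewrite -(evP U V).
(* Sending [a], [c] to the first unit vector, [b], [e] to the second and [d], [f] to the third kills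
   the first product and makes the second one equal to 1. *)
pose k (i : 'I_m) : nat := if (i == a) || (i == c) then 0%N
  else if (i == b) || (i == e) then 1%N else 2%N.
pose U' : 'M[K]_(m, 3) := \matrix_(i, l) (l == k i :> nat)%:R.
apply: (generic_transfer (L := K) (U' := U') (V' := 0) (fun=> id) gUV).
rewrite evP; move: u6; rewrite /= !inE !negb_or.
case/and5P=> /and5P[ab ac ad ae af] /and4P[bc bd be bf] /and3P[cd ce cf] /andP[de df].
case/andP=> ef _.
have [ka kb kc] : [/\ k a = 0%N, k b = 1%N & k c = 0%N].
  by rewrite /k !eqxx ?orbT [b == a]eq_sym (negbTE ab) (negbTE bc).
have [kd ke kf] : [/\ k d = 2%N, k e = 1%N & k f = 2%N].
  rewrite /k !eqxx !orbT [d == a]eq_sym [d == b]eq_sym [d == c]eq_sym.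
  rewrite [e == a]eq_sym [e == c]eq_sym [f == a]eq_sym [f == b]eq_sym.
  rewrite [f == c]eq_sym [f == e]eq_sym.
  by rewrite (negbTE ad) (negbTE bd) (negbTE cd) (negbTE de) (negbTE ae)
    (negbTE ce) (negbTE af) (negbTE bf) (negbTE cf) (negbTE ef).
rewrite /concurrency /triple !mxE ka kb kc kd ke kf !inordK //=.
rewrite (_ : _ - _ = -1); last by ring.
by rewrite oppr_eq0 oner_neq0.
Qed.

Section ThreeLines.
Variables (K : fieldType) (m : nat) (U : 'M[K]_(m, 3)).
Hypothesis detU : forall h : 'I_3 -> 'I_m, injective h -> \det (rowsub h U) != 0.

(** A linear form vanishing at the points of [S]; for two points it is a multiple of the equation of
    the line through them. *)
Definition perp (S : {set 'I_m}) (c : 'I_3 -> K) :=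
  forall i, i \in S -> \sum_a U i a * c a = 0.

Lemma perp0 (S : {set 'I_m}) c : (2 < #|S|)%N -> perp S c -> forall a, c a = 0.
Proof. exact: uniform_rows_span. Qed.

Lemma perpU S S' c : perp S c -> perp S' c -> perp (S :|: S') c.
Proof. by move=> pS pS' i; rewrite inE => /orP[]; [apply: pS|apply: pS']. Qed.

Lemma perpN S c : perp S c -> perp S (fun a => - c a).
Proof.
move=> pS i /pS pi; rewrite -[RHS]oppr0 -[in RHS]pi -sumrN.
by apply: eq_bigr => a _; rewrite mulrN.
Qed.

Lemma eq_perp S c c' : c =1 c' -> perp S c -> perp S c'.
Proof.
by move=> cc' pS i /pS pi; rewrite -[RHS]pi; apply: eq_bigr => a _; rewrite cc'.
Qed.

Lemma card2U (S S' : {set 'I_m}) :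
  #|S| = 2%N -> #|S'| = 2%N -> S != S' -> (2 < #|S :|: S'|)%N.
Proof.
move=> cS cS' nS; rewrite ltnNge; apply: contra nS => le2.
have SU : S == S :|: S' by rewrite eqEcard subsetUl cS.
have SU' : S' == S :|: S' by rewrite eqEcard subsetUr cS'.
by rewrite (eqP SU) {2}(eqP SU').
Qed.

Lemma two_lines (S S' : {set 'I_m}) c c' : #|S| = 2%N -> #|S'| = 2%N -> S != S' ->
  perp S c -> perp S' c' -> (forall a, c a + c' a = 0) ->
  (forall a, c a = 0) /\ (forall a, c' a = 0).
Proof.
move=> cS cS' nS pS pS' cc'.
have c0 : forall a, c a = 0.
  apply: perp0 (card2U cS cS' nS) _; apply: perpU pS _.
  by apply: eq_perp (perpN pS') => a; apply/eqP; rewrite eq_sym -addr_eq0 cc'.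
by split=> // a; have := cc' a; rewrite c0 add0r.
Qed.

(** At the common point [p] the first two forms vanish, hence so does [c3], which then has three
    zeros in general position. *)
Lemma meeting_lines (S1 S2 S3 : {set 'I_m}) c1 c2 c3 p :
  #|S1| = 2%N -> #|S2| = 2%N -> #|S3| = 2%N -> S1 != S2 ->
  p \in S1 -> p \in S2 -> p \notin S3 ->
  perp S1 c1 -> perp S2 c2 -> perp S3 c3 ->
  (forall a, c1 a + c2 a + c3 a = 0) ->
  [/\ forall a, c1 a = 0, forall a, c2 a = 0 & forall a, c3 a = 0].
Proof.
move=> cS1 cS2 cS3 n12 p1 p2 p3 h1 h2 h3 s0.
have c30 : forall a, c3 a = 0.
  apply: (@perp0 (p |: S3)); first by rewrite cardsU1 p3 cS3.
  apply: perpU h3 => i /set1P ->.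
  transitivity (- 0 - 0 : K); last by rewrite subr0 oppr0.
  rewrite -[X in _ = - X - _](h1 p p1) -[X in _ = _ - X](h2 p p2) -sumrN -sumrB.
  apply: eq_bigr => a _.
  have /eqP := s0 a; rewrite addrC addr_eq0 => /eqP ->.
  by rewrite mulrN mulrDr opprD.
have [|c10 c20] := two_lines cS1 cS2 n12 h1 h2; last by split.
by move=> a; have := s0 a; rewrite c30 addr0.
Qed.

(** The form [c3] is minus the sum of the other two, so it vanishes at the intersection [w] of the
    first two lines as well as at [e] and [f]. The determinant of these three vectors is the
    concurrency, which is nonzero. *)
Lemma three_lines a b c d e f c1 c2 c3 :
  concurrency U a b c d e f != 0 ->
  perp [set a; b] c1 -> perp [set c; d] c2 -> perp [set e; f] c3 ->
  (forall x, c1 x + c2 x + c3 x = 0) -> forall x, c3 x = 0.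
Proof.
move=> nz h1 h2 h3 s0.
pose dot i (v : 'I_3 -> K) :=
  U i (inord 0) * v (inord 0) + U i (inord 1) * v (inord 1) + U i (inord 2) * v (inord 2).
have perp_dot S v i : perp S v -> i \in S -> dot i v = 0.
  by move=> pS /pS; rewrite sum_ord3.
have a1 : dot a c1 = 0 by apply: perp_dot h1 _; rewrite !inE eqxx.
have b1 : dot b c1 = 0 by apply: perp_dot h1 _; rewrite !inE eqxx orbT.
have cc2 : dot c c2 = 0 by apply: perp_dot h2 _; rewrite !inE eqxx.
have d2 : dot d c2 = 0 by apply: perp_dot h2 _; rewrite !inE eqxx orbT.
have e3 : dot e c3 = 0 by apply: perp_dot h3 _; rewrite !inE eqxx.
have f3 : dot f c3 = 0 by apply: perp_dot h3 _; rewrite !inE eqxx orbT.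
have dotS i : dot i c3 = - dot i c1 - dot i c2.
  have c3E x : c3 x = - c1 x - c2 x.
    by apply/eqP; rewrite -opprD -addr_eq0 addrC s0.
  by rewrite /dot !c3E; ring.
pose w x := triple U a b c * U d x - triple U a b d * U c x.
have w3 : w (inord 0) * c3 (inord 0) + w (inord 1) * c3 (inord 1)
          + w (inord 2) * c3 (inord 2) = 0.
  transitivity (triple U a b c * dot d c3 - triple U a b d * dot c c3).
    by rewrite /w /dot; ring.
  rewrite !dotS cc2 d2 !subr0.
  (* The four-term relation between points of the plane rewrites [w] as a combination of [a] and
     [b], where [c1] vanishes. *)
  transitivity (triple U a c d * dot b c1 - triple U b c d * dot a c1).
    by rewrite /triple /dot; ring.
  by rewrite a1 b1 !mulr0 subr0.
(* Cramer's rule for the rows [w], [e], [f]. *)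
have crossE x : concurrency U a b c d e f * c3 x = 0.
  pose P (q : 'I_3) := concurrency U a b c d e f * c3 q == 0.
  suff : P (inord 0) && P (inord 1) && P (inord 2).
    rewrite /P => /andP[/andP[/eqP q0 /eqP q1] /eqP q2].
    case: x => -[|[|[|//]]] xP.
    - by rewrite -[RHS]q0; congr (_ * c3 _); apply: val_inj; rewrite /= inordK.
    - by rewrite -[RHS]q1; congr (_ * c3 _); apply: val_inj; rewrite /= inordK.
    - by rewrite -[RHS]q2; congr (_ * c3 _); apply: val_inj; rewrite /= inordK.
  rewrite /P; apply/andP; split; [apply/andP; split|]; apply/eqP.
  - transitivity ((w (inord 0) * c3 (inord 0) + w (inord 1) * c3 (inord 1)
          + w (inord 2) * c3 (inord 2)) *
        (U e (inord 1) * U f (inord 2) - U e (inord 2) * U f (inord 1))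
      - dot e c3 * (w (inord 1) * U f (inord 2) - w (inord 2) * U f (inord 1))
      + dot f c3 * (w (inord 1) * U e (inord 2) - w (inord 2) * U e (inord 1))).
      by rewrite /concurrency /w /triple /dot; ring.
    by rewrite w3 e3 f3; ring.
  - transitivity (- ((w (inord 0) * c3 (inord 0) + w (inord 1) * c3 (inord 1)
          + w (inord 2) * c3 (inord 2)) *
        (U e (inord 0) * U f (inord 2) - U e (inord 2) * U f (inord 0)))
      + dot e c3 * (w (inord 0) * U f (inord 2) - w (inord 2) * U f (inord 0))
      - dot f c3 * (w (inord 0) * U e (inord 2) - w (inord 2) * U e (inord 0))).
      by rewrite /concurrency /w /triple /dot; ring.
    by rewrite w3 e3 f3; ring.
  - transitivity ((w (inord 0) * c3 (inord 0) + w (inord 1) * c3 (inord 1)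
          + w (inord 2) * c3 (inord 2)) *
        (U e (inord 0) * U f (inord 1) - U e (inord 1) * U f (inord 0))
      - dot e c3 * (w (inord 0) * U f (inord 1) - w (inord 1) * U f (inord 0))
      + dot f c3 * (w (inord 0) * U e (inord 1) - w (inord 1) * U e (inord 0))).
      by rewrite /concurrency /w /triple /dot; ring.
    by rewrite w3 e3 f3; ring.
by move=> x; have /eqP := crossE x; rewrite mulf_eq0 (negbTE nz) => /eqP.
Qed.

Hypothesis concU : forall a b c d e f, uniq [:: a; b; c; d; e; f] ->
  concurrency U a b c d e f != 0.

Lemma nonconcurrent_lines (S1 S2 S3 : {set 'I_m}) c1 c2 c3 :
  #|S1| = 2%N -> #|S2| = 2%N -> #|S3| = 2%N ->
  S1 != S2 -> S1 != S3 -> S2 != S3 -> S1 :&: S2 :&: S3 = set0 ->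
  perp S1 c1 -> perp S2 c2 -> perp S3 c3 ->
  (forall a, c1 a + c2 a + c3 a = 0) ->
  [/\ forall a, c1 a = 0, forall a, c2 a = 0 & forall a, c3 a = 0].
Proof.
move=> cS1 cS2 cS3 n12 n13 n23 I0 h1 h2 h3 s0.
have nI p : p \in S1 -> p \in S2 -> p \in S3 -> False.
  by move=> p1 p2 p3; have := in_set0 p; rewrite -I0 !inE p1 p2 p3.
have [I12|/set0Pn[p]] := eqVneq (S1 :&: S2) set0; last first.
  rewrite inE => /andP[p1 p2]; apply: (meeting_lines cS1 cS2 cS3 n12 p1 p2) => //.
  by apply/negP => p3; apply: nI p1 p2 p3.
have [I13|/set0Pn[p]] := eqVneq (S1 :&: S3) set0; last first.
  rewrite inE => /andP[p1 p3].
  have [||c10 c30 c20] := meeting_lines cS1 cS3 cS2 n13 p1 p3 _ h1 h3 h2.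
  - by apply/negP => p2; apply: nI p1 p2 p3.
  - by move=> a; rewrite addrAC.
  by split.
have [I23|/set0Pn[p]] := eqVneq (S2 :&: S3) set0; last first.
  rewrite inE => /andP[p2 p3].
  have [||c20 c30 c10] := meeting_lines cS2 cS3 cS1 n23 p2 p3 _ h2 h3 h1.
  - by apply/negP => p1; apply: nI p1 p2 p3.
  - by move=> a; rewrite addrC addrA.
  by split.
have /cards2P[a [b [ab S1E]]] : #|S1| == 2%N by rewrite cS1.
have /cards2P[c [d [cd S2E]]] : #|S2| == 2%N by rewrite cS2.
have /cards2P[e [f [ef S3E]]] : #|S3| == 2%N by rewrite cS3.
have n12' x y : x \in S1 -> y \in S2 -> x != y.
  move=> x1 y2; apply/eqP => xy; have := in_set0 x.
  by rewrite -I12 inE x1 xy y2.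
have n13' x y : x \in S1 -> y \in S3 -> x != y.
  move=> x1 y2; apply/eqP => xy; have := in_set0 x.
  by rewrite -I13 inE x1 xy y2.
have n23' x y : x \in S2 -> y \in S3 -> x != y.
  move=> x1 y2; apply/eqP => xy; have := in_set0 x.
  by rewrite -I23 inE x1 xy y2.
have c30 : forall x, c3 x = 0.
  apply: (@three_lines a b c d e f c1 c2) => //; rewrite -?S1E -?S2E -?S3E //.
  apply: concU; rewrite /= !inE !negb_or ab cd ef.
  have [a1 b1] : a \in S1 /\ b \in S1 by rewrite S1E !inE !eqxx orbT.
  have [c2' d2] : c \in S2 /\ d \in S2 by rewrite S2E !inE !eqxx orbT.
  have [e3 f3] : e \in S3 /\ f \in S3 by rewrite S3E !inE !eqxx orbT.
  by rewrite (n12' a c) ?(n12' a d) ?(n12' b c) ?(n12' b d) ?(n13' a e)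
    ?(n13' a f) ?(n13' b e) ?(n13' b f) ?(n23' c e) ?(n23' c f) ?(n23' d e) ?(n23' d f).
have [|c10 c20] := two_lines cS1 cS2 n12 h1 h2; last by split.
by move=> x; have := s0 x; rewrite c30 addr0.
Qed.

End ThreeLines.

Section LineCounts.
Variables (K : fieldType) (m r : nat) (U : 'M[K]_(m, 3)).
Variables (L : 'I_r -> 'rV[K]_3) (P : 'I_r -> {set 'I_m}) (A : {set 'I_m}).
Variable D0 : {set 'I_r}.
Hypothesis detU : forall h : 'I_3 -> 'I_m, injective h -> \det (rowsub h U) != 0.
Hypothesis m3 : (3 <= m)%N.
Hypothesis LP : forall b i, i \in P b -> \sum_a U i a * L b 0 a = 0.
Hypothesis indL : forall c : 'I_r -> K, (forall b, b \notin D0 -> c b = 0) ->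
  (forall i, i \in A -> \sum_b c b * \sum_a U i a * L b 0 a = 0) ->
  forall b, c b = 0.

(** On the points of [A] the forms [L b], for [b] in [D], are independent functions, and all of them
    vanish outside the set counted on the right. *)
Lemma card_lines_le_points (D : {set 'I_r}) : D \subset D0 ->
  (#|D| <= #|[set i in A | [exists b in D, i \notin P b]]|)%N.
Proof.
move=> sD; set S := [set i in A | _]; rewrite leqNgt; apply/negP => ltSD.
pose N := \matrix_(k < #|D|, l < #|S|)
  \sum_a U (enum_val l) a * L (enum_val k) 0 a.
have : kermx N != 0.
  by rewrite kermx_eq0 /row_free neq_ltn (leq_ltn_trans (rank_leq_col _) ltSD).
rewrite -nz_row_eq0; set v := nz_row _; case/negP; apply/eqP.
have vN : v *m N = 0 by apply/sub_kermxP; apply: nz_row_sub.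
have [b0 b0D] : exists b0, b0 \in D by apply/card_gt0P; apply: leq_ltn_trans ltSD.
pose c b := if b \in D then v 0 (enum_rank_in b0D b) else 0.
suff c0 : forall b, c b = 0.
  apply/rowP => k; rewrite mxE -(c0 (enum_val k)) /c enum_valP.
  by rewrite enum_valK_in.
apply: indL => [b nb|i iA].
  by rewrite /c; case: ifP => // /(subsetP sD) bD; rewrite bD in nb.
have [iS|] := boolP (i \in S); last first.
  rewrite inE iA /= negb_exists_in => /forall_inP iP; rewrite big1 // => b _.
  rewrite /c; case: ifP => bD; last by rewrite mul0r.
  by rewrite LP ?mulr0 //; have := iP b bD; rewrite negbK.
move/rowP/(_ (enum_rank_in iS i)): vN; rewrite !mxE => vN; rewrite -[RHS]vN.
rewrite (bigID [pred b | b \in D]) /= [X in _ + X]big1 ?addr0; last first.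
  by move=> b /negbTE bD; rewrite /c bD mul0r.
rewrite big_enum_val; apply: eq_bigr => k _.
by rewrite !mxE /c enum_valP enum_valK_in enum_rankK_in.
Qed.

(** The forms are independent and all annihilate the points of [S], which are independent as well,
    inside a space of dimension 3. *)
Lemma card_lines_through (D : {set 'I_r}) (S : {set 'I_m}) : D \subset D0 ->
  (#|S| <= 3)%N -> (forall b, b \in D -> S \subset P b) -> (#|D| + #|S| <= 3)%N.
Proof.
move=> sD cS sP.
pose N := \matrix_(k < #|D|) L (enum_val k).
pose W := \matrix_(a < 3, l < #|S|) U (enum_val l) a.
have NW : N *m W = 0.
  apply/matrixP => k l; rewrite !mxE.
  rewrite -[RHS](LP (subsetP (sP _ (enum_valP k)) _ (enum_valP l))).
  by apply: eq_bigr => a _; rewrite !mxE mulrC.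
have rW : \rank W = #|S|.
  apply/eqP; rewrite -mxrank_tr; apply: inj_row_free => v vW.
  case: (set_0Vmem S) => [S0|[i0 i0S]].
    by apply/rowP => -[k kS]; exfalso; move: kS; rewrite S0 cards0.
  pose y i := if i \in S then v 0 (enum_rank_in i0S i) else 0.
  suff y0 : forall i, y i = 0.
    by apply/rowP => k; rewrite mxE -(y0 (enum_val k)) /y enum_valP enum_valK_in.
  apply: (uniform_rows_indep detU m3 cS) => [i /negbTE iS|a]; first by rewrite /y iS.
  move/rowP/(_ a): vW; rewrite !mxE => vW; rewrite -[RHS]vW.
  rewrite (bigID [pred i | i \in S]) /= [X in _ + X]big1 ?addr0; last first.
    by move=> i /negbTE iS; rewrite /y iS mul0r.
  rewrite big_enum_val; apply: eq_bigr => k _.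
  by rewrite !mxE /y enum_valP enum_valK_in.
have rN : \rank N = #|D|.
  apply/eqP; apply: inj_row_free => v vN.
  case: (set_0Vmem D) => [D0'|[b0 b0D]].
    by apply/rowP => -[k kD]; exfalso; move: kD; rewrite D0' cards0.
  pose c b := if b \in D then v 0 (enum_rank_in b0D b) else 0.
  suff c0 : forall b, c b = 0.
    by apply/rowP => k; rewrite mxE -(c0 (enum_val k)) /c enum_valP enum_valK_in.
  apply: indL => [b nb|i _].
    by rewrite /c; case: ifP => // /(subsetP sD) bD; rewrite bD in nb.
  under eq_bigr do rewrite mulr_sumr.
  rewrite exchange_big big1 // => a _.
  under eq_bigr do rewrite mulrCA.
  rewrite -mulr_sumr; move/rowP/(_ a): vN; rewrite !mxE => vN.
  rewrite [X in _ * X](_ : _ = 0) ?mulr0 // -[RHS]vN.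
  rewrite (bigID [pred b | b \in D]) /= [X in _ + X]big1 ?addr0; last first.
    by move=> b /negbTE bD; rewrite /c bD mul0r.
  rewrite big_enum_val; apply: eq_bigr => k _.
  by rewrite !mxE /c enum_valP enum_valK_in.
by rewrite -rN -rW; apply: mulmx0_rank_max.
Qed.

End LineCounts.

(** Independence over [K0] enters only through the two counts above, [G1] and [G2]. They bound the
    number of lines by three and exclude equal or concurrent lines where these would do harm, so the
    general position of [U] finishes each case. *)
Lemma lines_transfer (K0 K : fieldType) m r (U0 : 'M[K0]_(m, 3)) (U : 'M[K]_(m, 3))
    (L : 'I_r -> 'rV[K0]_3) (P : 'I_r -> {set 'I_m}) (A : {set 'I_m})
    (D0 : {set 'I_r}) :
  (3 <= m)%N ->
  (forall h : 'I_3 -> 'I_m, injective h -> \det (rowsub h U0) != 0) ->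
  (forall h : 'I_3 -> 'I_m, injective h -> \det (rowsub h U) != 0) ->
  (forall a b c d e f, uniq [:: a; b; c; d; e; f] -> concurrency U a b c d e f != 0) ->
  (forall b, b \in D0 -> #|P b| = 2%N) ->
  (forall b i, i \in P b -> \sum_a U0 i a * L b 0 a = 0) ->
  (forall c : 'I_r -> K0, (forall b, b \notin D0 -> c b = 0) ->
    (forall i, i \in A -> \sum_b c b * \sum_a U0 i a * L b 0 a = 0) ->
    forall b, c b = 0) ->
  forall C : 'I_r -> 'I_3 -> K, (forall b, b \in D0 -> perp U (P b) (C b)) ->
    perp U A (fun a => \sum_(b in D0) C b a) ->
    forall b, b \in D0 -> forall a, C b a = 0.
Proof.
move=> m3 detU0 detU concU cP LP indL C CP CA.
have G1 D := card_lines_le_points LP indL (D := D).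
have G2 D S := card_lines_through detU0 m3 LP indL (D := D) (S := S).
have G1_1 b : b \in D0 -> exists2 i, i \in A & i \notin P b.
  move=> bD; have := G1 [set b]; rewrite sub1set bD cards1 => /(_ isT).
  case/card_gt0P => i; rewrite inE => /andP[iA /exists_inP[b' /set1P-> ib]].
  by exists i.
have neqA b : b \in D0 -> P b != A.
  by move=> /G1_1[i iA iP]; apply/eqP => PA; rewrite PA iA in iP.
have neqP b b' : b \in D0 -> b' \in D0 -> b != b' -> P b != P b'.
  move=> bD bD' nb; apply/eqP => PP.
  have := G2 [set b; b'] (P b); rewrite subUset !sub1set bD bD' cP // cards2 nb.
  move=> /(_ isT isT) abs; have // : false.
  by apply: abs => b1 /set2P[]->; rewrite ?PP.
have cD0 : (#|D0| <= 3)%N.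
  by have := G2 D0 set0; rewrite cards0 addn0; apply => // b _; apply: sub0set.
case: (set_0Vmem D0) => [->|[b1 b1D]] b; first by rewrite inE.
have D1 : #|D0| = #|D0 :\ b1|.+1 by rewrite (cardsD1 b1) b1D.
have [D1_0|[b2]] := set_0Vmem (D0 :\ b1).
  have D0E : D0 = [set b1] by rewrite -(setD1K b1D) D1_0 setU0.
  rewrite D0E => /set1P ->; have [i iA iP] := G1_1 b1 b1D.
  apply: (@perp0 _ _ _ detU (i |: P b1)); first by rewrite cardsU1 iP cP.
  apply: perpU (CP _ b1D) => _ /set1P->; have := CA i iA.
  by rewrite D0E; under eq_bigr do rewrite big_set1.
rewrite in_setD1 => /andP[b21 b2D].
have D2 : #|D0| = #|D0 :\ b1 :\ b2|.+2.
  by rewrite D1 (cardsD1 b2 (D0 :\ b1)) in_setD1 b21 b2D.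
have b12 : b1 != b2 by rewrite eq_sym.
have D12 : (D0 = b1 |: (b2 |: (D0 :\ b1 :\ b2))).
  by rewrite setD1K ?in_setD1 ?b21 // setD1K.
have sumD0 a : \sum_(b in D0) C b a =
    C b1 a + C b2 a + \sum_(b in D0 :\ b1 :\ b2) C b a.
  rewrite (bigD1 b1) //= (bigD1 b2) ?b2D //= addrA; congr (_ + _).
  by apply: eq_bigl => b'; rewrite !in_setD1 [RHS]andbC; congr (_ && _); apply: andbC.
have [D2_0|[b3]] := set_0Vmem (D0 :\ b1 :\ b2).
  have CA12 : perp U A (fun a => C b1 a + C b2 a).
    by apply: eq_perp CA => a; rewrite sumD0 D2_0 big_set0 addr0.
  have S2 : (2 <= #|[set i in A | [exists b in D0, i \notin P b]]|)%N.
    by apply: leq_trans (G1 D0 (subxx _)); rewrite D2.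
  have [c10 c20] : (forall a, C b1 a = 0) /\ (forall a, C b2 a = 0).
    (* With at least three points in [A] the sum is zero. Otherwise [A] has two points, neither on
       both lines, and minus the sum is a form on a third, nonconcurrent line. *)
    have [cA|cA] := ltnP 2 #|A|.
      apply: (two_lines detU (cP _ b1D) (cP _ b2D) (neqP _ _ b1D b2D b12)
               (CP _ b1D) (CP _ b2D)).
      exact: (perp0 detU cA CA12).
    have SA : [set i in A | [exists b in D0, i \notin P b]] == A.
      rewrite eqEcard (leq_trans cA S2) andbT; apply/subsetP => i.
      by rewrite inE => /andP[].
    have cA2 : #|A| = 2%N by apply/eqP; rewrite eqn_leq cA -(eqP SA).
    have [||c10 c20 _] := nonconcurrent_lines detU concU (cP _ b1D) (cP _ b2D) cA2
      (neqP _ _ b1D b2D b12) (neqA _ b1D) (neqA _ b2D) _ (CP _ b1D) (CP _ b2D)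
      (perpN CA12).
    - apply/setP => i; rewrite !inE; apply/negP => /andP[/andP[i1 i2] iA].
      move: (iA); rewrite -{1}(eqP SA) inE iA => /exists_inP[b'].
      rewrite D12 D2_0 setU0 => /set2P[]->; by rewrite ?i1 ?i2.
    - by move=> a; rewrite subrr.
    by split.
  by rewrite D12 D2_0 setU0 => /set2P[]->.
rewrite !in_setD1 => /and3P[b32 b31 b3D].
have D3 : D0 :\ b1 :\ b2 = [set b3].
  apply/esym/eqP; rewrite eqEcard sub1set !in_setD1 b32 b31 b3D cards1.
  by move: cD0; rewrite D2 !ltnS.
have b13 : b1 != b3 by rewrite eq_sym.
have b23 : b2 != b3 by rewrite eq_sym.
have cA : (2 < #|A|)%N.
  have := G1 D0 (subxx _); rewrite {1}D2 D3 cards1 => /leq_trans; apply.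
  by apply: subset_leq_card; apply/subsetP => i; rewrite inE => /andP[].
have sum0 : forall a, C b1 a + C b2 a + C b3 a = 0.
  apply: (perp0 detU cA).
  by apply: eq_perp CA => a; rewrite sumD0 D3 big_set1.
have [|c10 c20 c30] := nonconcurrent_lines detU concU (cP _ b1D) (cP _ b2D) (cP _ b3D)
    (neqP _ _ b1D b2D b12) (neqP _ _ b1D b3D b13) (neqP _ _ b2D b3D b23) _
    (CP _ b1D) (CP _ b2D) (CP _ b3D) sum0.
  apply/setP => i; rewrite !inE; apply/negP => /andP[/andP[i1 i2] i3].
  have := G2 D0 [set i]; rewrite subxx cards1 D2 D3 cards1 => /(_ isT isT) abs.
  have // : false; apply: abs => b'.
  by rewrite D12 D3 sub1set => /setU1P[|/set2P[]]->.
by rewrite D12 D3 => /setU1P[|/set2P[]]->.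
Qed.

(** * Columns with many large fibres *)

(** Normalise [r] columns having at least two elements. Column [b] of a form [C] vanishing on [E] is
    then zero if [P b] has three points, and a multiple of the equation [L b] of a line if it has
    two. Over [K0] the vectors [w b] record the values of these lines on the other columns of [E];
    choosing one column [g b] for each line keeps them independent and decouples the columns. *)
Lemma spans_many_large_columns_transfer (K0 K : fieldType) m n r
    (U0 : 'M[K0]_(m, 3)) (V0 : 'M[K0]_(n, r)) (U : 'M[K]_(m, 3))
    (E : {set 'I_m * 'I_n}) :
  (3 <= m)%N ->
  (forall h : 'I_3 -> 'I_m, injective h -> \det (rowsub h U0) != 0) ->
  (forall h : 'I_r -> 'I_n, injective h -> \det (rowsub h V0) != 0) ->
  (forall h : 'I_3 -> 'I_m, injective h -> \det (rowsub h U) != 0) ->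
  (forall a b c d e f, uniq [:: a; b; c; d; e; f] -> concurrency U a b c d e f != 0) ->
  (r <= #|[set j | (1 < #|[set i | (i, j) \in E]|)%N]|)%N ->
  spans_at U0 V0 E -> exists V : 'M[K]_(n, r), spans_at U V E.
Proof.
move=> m3 detU0 detV0 detU concU cJ spE.
pose A j := [set i | (i, j) \in E]; set J := [set j | _] in cJ.
have [|B [_ sBJ cB]] := subset_of_card (sub0set J) (k := r).
  by rewrite cards0.
have [kap kap_inj defB] := enum_base cB.
have [V1 V1kap sp1] := normalized_rows (detV0 _ kap_inj) spE.
pose P b := A (kap b).
have cP b : (1 < #|P b|)%N.
  have : kap b \in J by apply: (subsetP sBJ); rewrite defB imset_f.
  by rewrite inE.
pose N b := \matrix_(k < #|P b|) row (enum_val k) U0.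
pose L b : 'rV[K0]_3 := nz_row (kermx (N b)^T).
have LP b i : i \in P b -> \sum_a U0 i a * L b 0 a = 0.
  move=> iP; have LN : L b *m (N b)^T = 0 by apply/sub_kermxP; apply: nz_row_sub.
  move/rowP/(_ (enum_rank_in iP i)): LN; rewrite !mxE => LN; rewrite -[RHS]LN.
  by apply: eq_bigr => a _; rewrite !mxE enum_rankK_in // mulrC.
pose R := [set b | #|P b| == 2%N].
have L0 b : b \in R -> L b != 0.
  rewrite inE => /eqP cb; rewrite nz_row_eq0 kermx_eq0 /row_free mxrank_tr.
  by rewrite neq_ltn (leq_ltn_trans (rank_leq_row _)) // cb.
pose dot b i := \sum_a U0 i a * L b 0 a.
pose v b j := if j \in B then 0 else V1 j b.
pose w b j : 'M[K0]_(m, n) :=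
  \matrix_(i, j') if (j' == j) && ((i, j) \in E) then dot b i else 0.
have [g /[!inE]/free_imageP indg vg] : exists2 g : 'I_r -> 'I_n,
    R \in linear_indep (fun b => w b (g b)) & forall b, b \in R -> v b (g b) != 0.
  apply: (linear_indep_choice kap); rewrite inE; apply/free_imageP => c c0.
  (* A relation between the sums, used as coefficients of the lines, is a form vanishing on all of
     [E]. *)
  pose C : 'M[K0]_(3, r) := \matrix_(a, b) if b \in R then c b * L b 0 a else 0.
  have C0 : C = 0.
    apply: sp1 => i j ijE; rewrite mulmx3E exchange_big /=.
    transitivity (\sum_(b in R) c b * (V1 j b * dot b i)).
      rewrite [RHS]big_mkcond; apply: eq_bigr => b _ /=.
      case: (boolP (b \in R)) => bR; last first.
        by rewrite big1 // => a _; rewrite !mxE (negbTE bR) mulr0 mul0r.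
      rewrite /dot !mulr_sumr; apply: eq_bigr => a _.
      by rewrite !mxE bR; ring.
    have [jB|jB] := boolP (j \in B).
      move: jB ijE; rewrite defB => /imsetP[k _ ->] kE.
      rewrite big1 // => b _; rewrite V1kap; case: eqP => [<-|_].
        by rewrite /dot LP ?mulr0 // inE.
      by rewrite mul0r mulr0.
    move/matrixP/(_ i j): c0; rewrite summxE mxE => c0; rewrite -[RHS]c0.
    apply: eq_bigr => b _; rewrite mxE summxE; congr (_ * _).
    rewrite (bigD1 j) //= [X in _ + X]big1 ?addr0 => [|j' nj].
      by rewrite !mxE eqxx ijE /v (negbTE jB).
    by rewrite !mxE eq_sym (negbTE nj) mulr0.
  move=> b bR; have /rV0Pn[a La] := L0 b bR; apply/eqP.
  move/matrixP/(_ a b): C0; rewrite !mxE bR => /eqP.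
  by rewrite mulf_eq0 (negbTE La) orbF.
have gB b : b \in R -> g b \notin B.
  by move=> /vg; rewrite /v; case: ifP => //; rewrite eqxx.
(* Outside [B], coordinate [b] is concentrated in the single row [g b]. *)
pose V' : 'M[K]_(n, r) :=
  \matrix_(j, b) if j \in B then (j == kap b)%:R else (g b == j)%:R.
exists V' => C CE.
have UCV i j : (U *m C *m V'^T) i j = \sum_a U i a * (\sum_b C a b * V' j b).
  rewrite mulmx3E; apply: eq_bigr => a _; rewrite mulr_sumr.
  by apply: eq_bigr => b _; rewrite mxE mulrA.
have V'kap b b' : V' (kap b) b' = (b == b')%:R.
  by rewrite mxE defB imset_f // (inj_eq kap_inj).
have CP b : perp U (P b) (fun a => C a b).
  move=> i; rewrite inE => ibE; rewrite -[RHS](CE _ _ ibE) UCV.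
  apply: eq_bigr => a _; congr (_ * _).
  rewrite [RHS](bigD1 b) //= [X in _ + X]big1 ?addr0 => [|b' nb].
    by rewrite V'kap eqxx mulr1.
  by rewrite V'kap eq_sym (negbTE nb) mulr0.
have Cbig b : b \notin R -> forall a, C a b = 0.
  rewrite inE => nb; apply: (@perp0 _ _ _ detU (P b)) (CP b).
  by rewrite ltn_neqAle eq_sym nb cP.
have CR b : b \in R -> forall a, C a b = 0.
  move=> bR; pose j := g b; have jB : j \notin B by apply: gB.
  pose D0 := [set b in R | g b == j].
  apply: (@lines_transfer K0 K m r U0 U L P (A j) D0 m3 detU0 detU concU _ LP _
           (fun b a => C a b)); last 1 first.
  - by rewrite inE bR eqxx.
  - by move=> b'; rewrite !inE => /andP[/eqP].
  - move=> c cD cA; have cR : forall b', b' \in R -> c b' = 0.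
      apply: indg; apply/matrixP => i j'; rewrite summxE mxE.
      have [|nE] := boolP ((i, j') \in E); last first.
        rewrite big1 // => b' _; rewrite !mxE.
        case: eqP => [<-|_] /=; last exact: mulr0.
        by rewrite (negbTE nE) mulr0.
      have [->|nj] := eqVneq j' j => ijE; last first.
        rewrite big1 // => b' _; rewrite !mxE.
        case: eqP => [j'E|_] /=; last exact: mulr0.
        by rewrite cD ?mul0r // !inE -j'E (negbTE nj) andbF.
      have iA : i \in A j by rewrite inE.
      rewrite -[RHS](cA i iA) [RHS](bigID [pred b | b \in R]) /=.
      rewrite [X in _ = _ + X]big1 ?addr0 => [|b' nb]; last first.
        by rewrite cD ?mul0r // inE (negbTE nb).
      apply: eq_bigr => b' b'R; rewrite !mxE eq_sym.
      have [->|nj] := eqVneq (g b') j; first by rewrite ijE.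
      by rewrite (cD b') ?mul0r // inE (negbTE nj) andbF.
    move=> b'; have [/cR//|nb] := boolP (b' \in R).
    by apply: cD; rewrite inE (negbTE nb).
  - by move=> b' _; apply: CP.
  move=> i; rewrite inE => ijE; rewrite -[RHS](CE _ _ ijE) UCV.
  apply: eq_bigr => a _; congr (_ * _); rewrite big_mkcond /=.
  apply: eq_bigr => b' _; rewrite mxE (negbTE jB) inE.
  case: (boolP (b' \in R)) => b'R /=; last by rewrite Cbig ?mul0r.
  by case: (g b' == j); rewrite ?mulr1 ?mulr0.
apply/matrixP => a b; rewrite [RHS]mxE.
by have [/CR|/Cbig] := boolP (b \in R).
Qed.

(** * The main theorem *)

Lemma card_columns m n (E : {set 'I_m * 'I_n}) k :
  (k * #|[set j | (k <= #|[set i | (i, j) \in E]|)%N]| <= #|E|)%N.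
Proof.
have -> : #|E| = (\sum_j #|[set i | (i, j) \in E]|)%N.
  transitivity (\sum_i \sum_j ((i, j) \in E : nat))%N.
    rewrite pair_bigA -sum1_card [LHS]big_mkcond /=; apply: eq_bigr => -[i j] _ /=.
    by case: (_ \in E).
  rewrite exchange_big; apply: eq_bigr => j _; rewrite -sum1dep_card [RHS]big_mkcond.
  by apply: eq_bigr => i _; case: (_ \in E).
rewrite mulnC -sum_nat_const [leqRHS](bigID [pred j | (k <= #|[set i | (i, j) \in E]|)%N]) /=.
apply: leq_trans (leq_addr _ _); rewrite (eq_bigl (fun j => (k <= #|[set i | (i, j) \in E]|)%N)).
  exact: leq_sum.
by move=> j; rewrite inE.
Qed.

(** Supplies, for any [K], an infinite field in which the mergings can be undone and in which the
    same integers vanish. *)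
Lemma fraction_powers_inj (K : fieldType) :
  injective (fun k => tofrac ('X ^+ k) : {fraction {poly K}}).
Proof.
move=> k l /eqP; rewrite tofrac_eq => /eqP/(congr1 (fun q : {poly K} => size q)).
by rewrite !size_polyXn => -[].
Qed.

Lemma fraction_intr0 (K : fieldType) (z : int) :
  z%:~R != 0 :> {fraction {poly K}} -> z%:~R != 0 :> K.
Proof.
apply: contra => /eqP z0; rewrite -(rmorph_int (@tofrac {poly K})).
suff -> : z%:~R = 0 :> {poly K} by rewrite rmorph0.
by rewrite -polyC0 -z0 (rmorph_int (@polyC K)).
Qed.

Lemma generic_spans_transfer (m n s r : nat) (hs : (s <= m)%N) (hr : (r <= n)%N)
    (h : (s <= 3)%N \/ (m - s <= 1)%N \/ (m - s = 2 /\ n - r = 2)%N)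
    (K : fieldType)
    (U : 'M[K]_(m, s)) (V : 'M[K]_(n, r)) (hUV : generic_vectors U V)
    (K0 : fieldType) (hK0 : has_char K0 0)
    (U0 : 'M[K0]_(m, s)) (V0 : 'M[K0]_(n, r)) (hUV0 : generic_vectors U0 V0)
    (E : {set 'I_m * 'I_n}) :
  #|E| = (s * r)%N -> spans_at U0 V0 E -> spans_at U V E.
Proof.
move=> cE spE; have detU0 := fun h => generic_det_rowsubU (h := h) hUV0.
have detV0 := fun h => generic_det_rowsubV (h := h) hUV0.
have detU := fun h => generic_det_rowsubU (h := h) hUV.
have special (V' : 'M[K]_(n, r)) (U' : 'M[K]_(m, s)) : spans_at U' V' E -> spans_at U V E.
  exact: generic_spans (fun=> id) hUV cE.
have [r0|r_gt0] := posnP r.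
  by move=> C _; move: C; rewrite r0 => C; apply: thinmx0.
have [s_le3|[corank1|[ms nr]]] := h; last 1 first.
- have ms' : m = (s + 2)%N by lia.
  have nr' : n = (r + 2)%N by lia.
  have nat_inj : injective (fun k : nat => k%:R : K0).
    move=> k l kl; apply/eqP; rewrite -eqz_nat -subr_eq0 -absz_eq0 -dvd0n.
    by rewrite -(has_char_intr0 _ (or_introl erefl) hK0) rmorphB /= -!pmulrn kl subrr.
  have [U' [V' spE']] := spans_two_two_transfer nat_inj (@fraction_powers_inj K)
    ms' nr' detU0 detV0 spE.
  exact: (generic_spans (@fraction_intr0 K) hUV cE spE').
- have [J_le|J_gt] := leqP #|[set j | (1 < #|[set i | (i, j) \in E]|)%N]| r.
    have r_bd : (0 < r <= n)%N by rewrite r_gt0.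
    have [V' spE'] := spans_few_large_columns_transfer hs r_bd cE detU detV0 J_le spE.
    exact: special spE'.
  (* More than [r] columns with two elements each need more than [2 * r] elements, while [E] has
     [s * r]. *)
  have s3 : s = 3%N.
    have := card_columns E 2; rewrite cE.
    by move: s_le3 J_gt; case: s {hs h cE spE detU0 detU special hUV hUV0 U V U0 V0 detV0} => [|[|[|[|//]]]]; lia.
  subst s; have [V' spE'] := spans_many_large_columns_transfer hs detU0 detV0 detU
    (fun a b c d e f => @generic_concurrency K m n r U V a b c d e f hUV) (ltnW J_gt) spE.
  exact: special spE'.
- have wi : injective (widen_ord hs) by move=> i j []/ord_inj.
  have ms : m = (s + (m - s))%N by rewrite subnKC.
  have [U' [V' spE']] := spans_corank_le1_transfer ms corank1
    (rank_det_rowsub (detU0 _ wi)) hUV spE.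
  exact: special spE'.
Qed.

Theorem theorem1p6 (m n s r p : nat)
    (hs : (s <= m)%N) (hr : (r <= n)%N) (hp : p = 0%N \/ prime p)
    (h : (s <= 3)%N \/ (m - s <= 1)%N \/ (m - s = 2 /\ n - r = 2)%N)
    (K : fieldType) (hK : has_char K p)
    (U : 'M[K]_(m, s)) (V : 'M[K]_(n, r)) (hUV : generic_vectors U V)
    (K0 : fieldType) (hK0 : has_char K0 0)
    (U0 : 'M[K0]_(m, s)) (V0 : 'M[K0]_(n, r)) (hUV0 : generic_vectors U0 V0) :
  tensor_matroid U V = tensor_matroid U0 V0.
Proof.
apply: tensor_matroid_eq; [exact: generic_spans_setT|exact: generic_spans_setT|].
move=> E cE; split=> spE; last first.
  exact: (generic_spans_transfer hs hr h hUV hK0 hUV0 cE spE).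
(* Integers that vanish in characteristic 0 vanish in every characteristic, so this direction is
   plain specialisation. *)
apply: (generic_spans _ hUV0 cE spE) => z; apply: contra.
rewrite (has_char_intr0 _ (or_introl erefl) hK0) (has_char_intr0 _ hp hK) dvd0n.
by move/eqP->; apply: dvdn0.
Qed.
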